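(* Let $\mathcal{C}$ be a finite abstract simplicial complex, let $\mathcal{V}=\{V_1,\ldots,V_n\}$ be a partition of $V(\mathcal{C})$, let $d\ge0$ be an integer, and let $\eta\in\{\eta_\pi,\eta_H\}$. If $\eta(\mathcal{C}[V_I])\ge|I|-d+1$ for all nonempty $I\subseteq[n]$, where $V_I=\bigcup_{i\in I}V_i$, then $\mathbf{RG}(\mathcal{C},\mathcal{V};n-d)$ is connected.
   Context: $\mathcal{C}[X]=\{\sigma\in\mathcal{C}:\sigma\subseteq X\}$. $\eta_\pi(\mathcal{K})$ (resp. $\eta_H(\mathcal{K})$) is $2$ plus the largest $k\ge-2$ such that $\mathcal{K}$ is homotopically $j$-connected (resp. $\widetilde H_j(\mathcal{K};\mathbb{Q})=0$) for all $-1\le j\le k$, where $(-1)$-connectedness / $\widetilde H_{-1}=0$ means $\mathcal{K}$ has at least one vertex; possibly $\infty$. A partial colorful simplex is a simplex of $\mathcal{C}$ with at most one vertex from each class $V_i$. $\mathbf{RG}(\mathcal{C},\mathcal{V};k)$ has as vertices the partial colorful simplices of cardinality $k$, two being adjacent if their union is a simplex of $\mathcal{C}$ of cardinality $k+1$. *)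

(* Defs.v *)
From HB Require Import structures.
From mathcomp Require Import all_boot all_order all_algebra.
From mathcomp Require Import all_classical all_reals all_analysis.
From mathcomp Require Import Rstruct Rstruct_topology.
From Stdlib Require Import Rdefinitions.

Set Implicit Arguments.
Unset Strict Implicit.
Unset Printing Implicit Defensive.

Import Order.TTheory GRing.Theory Num.Theory.
Import numFieldNormedType.Exports.

Local Open Scope ring_scope.

Section Complexes.
Variable T : finType.

Definition is_complex (C : {set {set T}}) : Prop :=
  finset.set0 \in C /\ forall s t : {set T}, s \in C -> t \subset s -> t \in C.

Definition cvertices (C : {set {set T}}) : {set T} :=
  [set v | (finset.set1 v) \in C].

Definition induced (C : {set {set T}}) (X : {set T}) : {set {set T}} :=
  [set s in C | s \subset X].

Definition faces (K : {set {set T}}) (s : nat) : {set {set T}} :=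
  [set x in K | #|x| == s].

(** incidence number [sigma : tau] for the oriented boundary, the
    orientation being induced by the enumeration order of T *)
Definition bdcoef (sigma tau : {set T}) : rat :=
  \sum_(v in sigma)
     (if tau == sigma :\ v
      then (-1) ^+ #|[set u in sigma | leq (enum_rank u).+1 (enum_rank v)]|
      else 0).

(** matrix of the (augmented) boundary map C_{s-1} -> C_{s-2}, with rows
    indexed by faces of cardinality s and columns by faces of cardinality s-1
    (for s = 1 this is the augmentation onto the empty face) *)
Definition bdmx (K : {set {set T}}) (s : nat) :
    'M[rat]_(#|faces K s|, #|faces K s.-1|) :=
  \matrix_(i, j) bdcoef (enum_val i) (enum_val j).

(** reduced homology over Q vanishes in dimension j >= 0:
    dim C_j = rank d_j + rank d_{j+1}  (i.e. ker d_j = im d_{j+1}) *)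
Definition hred_vanish (K : {set {set T}}) (j : nat) : Prop :=
  #|faces K j.+1| = (\rank (bdmx K j.+1) + \rank (bdmx K j.+2))%N.

Section Geometric.
Local Open Scope classical_set_scope.

Definition realization (K : {set {set T}}) : set 'rV[R]_#|T| :=
  [set x | (forall i, 0 <= x ord0 i) /\ \sum_i x ord0 i = 1 /\
           finset (fun v => 0 < x ord0 (enum_rank v)) \in K].

Definition sphere (m : nat) : set 'rV[R]_m.+1 := [set x | `|x| = 1].
Definition disk (m : nat) : set 'rV[R]_m.+1 := [set x | `|x| <= 1].

Definition homot_vanish (K : {set {set T}}) (j : nat) : Prop :=
  forall f : 'rV[R]_j.+1 -> 'rV[R]_#|T|,
    {within (@sphere j), continuous f} ->
    (forall x, (@sphere j) x -> realization K (f x)) ->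
    exists g : 'rV[R]_j.+1 -> 'rV[R]_#|T|,
      [/\ {within (@disk j), continuous g},
          (forall x, (@disk j) x -> realization K (g x)) &
          (forall x, (@sphere j) x -> g x = f x)].

End Geometric.

Inductive eta_kind := EtaPi | EtaH.

(** the j-th condition, j >= -1; the (-1)-condition is "K has a vertex" *)
Definition eta_cond (e : eta_kind) (K : {set {set T}}) (j : int) : Prop :=
  match j with
  | Posz k => match e with EtaPi => homot_vanish K k | EtaH => hred_vanish K k end
  | Negz _ => exists v : T, (finset.set1 v) \in K
  end.

(** eta(K) >= m, where eta(K) = 2 + the largest k >= -2 such that the
    j-th condition holds for all -1 <= j <= k (possibly infinity).
    Unfolded: eta(K) >= m iff the conditions hold for all -1 <= j <= m - 2. *)
Definition eta_ge (e : eta_kind) (K : {set {set T}}) (m : int) : Prop :=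
  forall j : int, (- 1 : int) <= j -> j <= m - 2 -> eta_cond e K j.

Definition pcolorful (n : nat) (C : {set {set T}}) (V : 'I_n -> {set T})
    (s : {set T}) : bool :=
  (s \in C) && [forall i, leq #|s :&: V i| 1].

Definition rg_vertex (n : nat) (C : {set {set T}}) (V : 'I_n -> {set T})
    (k : nat) (s : {set T}) : bool :=
  pcolorful C V s && (#|s| == k).

Definition rg_adj (n : nat) (C : {set {set T}}) (V : 'I_n -> {set T})
    (k : nat) : rel {set T} :=
  fun s t => [&& rg_vertex C V k s, rg_vertex C V k t,
                 (s :|: t) \in C & #|s :|: t| == k.+1].

Definition rg_connected (n : nat) (C : {set {set T}}) (V : 'I_n -> {set T})
    (k : nat) : Prop :=
  (exists s, rg_vertex C V k s) /\
  forall s t, rg_vertex C V k s -> rg_vertex C V k t -> connect (rg_adj C V k) s t.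

Definition is_vpartition (n : nat) (C : {set {set T}}) (V : 'I_n -> {set T}) : Prop :=
  [/\ forall i, V i != finset.set0,
      forall i j, i != j -> [disjoint V i & V j] &
      \bigcup_(i < n) V i = cvertices C].

End Complexes.

(* Main.v *)
From mathcomp Require Import all_classical all_reals all_analysis.
From mathcomp Require Import Rstruct Rstruct_topology.
Require Import Defs.
From mathcomp Require Import all_boot all_order all_algebra ring lra zify.

Set Implicit Arguments.
Unset Strict Implicit.
Unset Printing Implicit Defensive.

(** Let [Q_I], for a set [I] of colours, be the face [x_i = 1 (i \in I)] of the
    cube [[0,1]^n]. The faces of the cube on which at least [d + 1] coordinates
    are equal to 1, times a time interval, carry a chain map [Phi] into the
    simplicial chains of [C]: a face on which the nonzero coordinates are those
    in [J] goes to [C[V_J]], whose connectivity is just what is needed to extend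
    [Phi] from the boundary of the face. For homology this is the method of
    acyclic carriers. For homotopy one extends a continuous map face by face and
    labels the points of a fine grid by vertices of [C], so that the labels on
    each small cube form a simplex; acyclic carriers then apply to the grid.
    Moreover, at times 0 and 1, [Phi] may be prescribed to live in two given
    colorful simplices [S0] and [S1] with [n - d] vertices.

    Let [c] be the chain map induced by the colouring and let [deg Phi] be the sum
    over [#|I| = d + 1] of the coefficient of [~: I] in the boundary of
    [c (Phi Q_I)]. By Stokes' formula this number is the augmentation of the
    image of the vertex [(1, ..., 1)], namely 1; so colorful simplices with
    [n - d] vertices exist. Its part supported on one connected component of the
    reconfiguration graph does not depend on time, because all colorful facets of
    a simplex with [n - d + 1] vertices lie in the same component. At time 0 this
    part is 1 for the component of [S0], so at time 1 that component contains
    [S1]. *)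

(** * Chains *)

Section Chains.
Local Open Scope ring_scope.
Import GRing.Theory Num.Theory.

Definition inc_sgn (X : finType) (r : X -> nat) (A : {set X}) (x : X) : rat :=
  (-1) ^+ #|[set y in A | (r y < r x)%N]|.

(** The boundary is written coefficientwise: the value at [A] collects the simplices having [A] as a
    facet. The value at [set0] is the augmentation. *)
Definition bd (X : finType) (r : X -> nat) (z : {set X} -> rat) (A : {set X}) : rat :=
  \sum_(x | x \notin A) inc_sgn r A x * z (x |: A).

Definition supported (X : finType) (z : {set X} -> rat) (K : {set {set X}}) (s : nat) :=
  forall A, z A != 0 -> A \in K /\ #|A| = s.

(* Chains are graded by cardinality: [fillable r K s] is the vanishing of the
   reduced homology of [K] in dimension [s - 1]. *)
Definition fillable (X : finType) (r : X -> nat) (K : {set {set X}}) (s : nat) :=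
  forall z, supported z K s -> (forall A, bd r z A = 0) ->
  exists2 w, supported w K s.+1 & forall A, bd r w A = z A.

Section BdTheory.
Variables (X : finType) (r : X -> nat).
Hypothesis r_inj : injective r.
Implicit Types (A B : {set X}) (x y : X) (z w : {set X} -> rat).

Lemma inc_sgnU1 A x y : y \notin A ->
  inc_sgn r (y |: A) x = (-1) ^+ (r y < r x)%N * inc_sgn r A x.
Proof.
move=> yA; rewrite /inc_sgn -exprD; congr (_ ^+ _).
rewrite (cardsD1 y) !inE eqxx /=; congr (_ + _)%N.
by apply: eq_card => w; rewrite !inE; case: eqP => // ->; rewrite (negPf yA).
Qed.

Lemma inc_sgnD1 A x : inc_sgn r (A :\ x) x = inc_sgn r A x.
Proof.
congr (_ ^+ _); apply: eq_card => w; rewrite !inE.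
by case: eqP => // ->; rewrite ltnn !andbF.
Qed.

Lemma inc_sgn_self A x : inc_sgn r (x |: A) x = inc_sgn r A x.
Proof.
congr (_ ^+ _); apply: eq_card => w; rewrite !inE.
by case: eqP => // ->; rewrite ltnn !andbF.
Qed.

Lemma inc_sgn_swap A x y : x \notin A -> y \notin A -> x != y ->
  inc_sgn r A x * inc_sgn r (x |: A) y = - (inc_sgn r A y * inc_sgn r (y |: A) x).
Proof.
move=> xA yA xy; rewrite !inc_sgnU1 //; have : r x != r y by rewrite (inj_eq r_inj).
by case: ltngtP => //= _ _; rewrite ?expr0 ?expr1; ring.
Qed.

Lemma inc_sgn_sq A x : inc_sgn r A x * inc_sgn r A x = 1.
Proof. by rewrite /inc_sgn -exprMn mulN1r opprK expr1n. Qed.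

(** Exchanging the two indices shows that the sum is its own opposite. This is the cancellation
    behind the vanishing of the squared boundary, both simplicial and cubical. *)
Lemma sum_antisym (I : finType) (P : pred I) (f : I -> I -> rat) :
  (forall i j, P i -> P j -> i != j -> f i j = - f j i) ->
  \sum_(i | P i) \sum_(j | P j && (j != i)) f i j = 0.
Proof.
move=> asym; set S := (X in X = 0).
have : S = - S.
  rewrite {1}/S (exchange_big_dep P) /=; last by move=> i j _ /andP[].
  rewrite -sumrN; apply: eq_bigr => j Pj; rewrite -sumrN.
  apply: eq_big => [i|i /andP[Pi /andP[_ ji]]].
    by rewrite Pj eq_sym.
  by rewrite asym // eq_sym.
by move=> /eqP; rewrite -addr_eq0 -mulr2n mulrn_eq0 => /eqP.
Qed.

Lemma bd_bd z A : bd r (bd r z) A = 0.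
Proof.
rewrite -[RHS](@sum_antisym X (fun x => x \notin A)
   (fun x y => inc_sgn r A x * inc_sgn r (x |: A) y * z (y |: (x |: A)))).
  apply: eq_bigr => x xA; rewrite /bd mulr_sumr.
  apply: eq_big => [y|y _]; last by rewrite mulrA.
  by rewrite !inE negb_or andbC.
by move=> x y xA yA xy; rewrite inc_sgn_swap // mulNr setUCA.
Qed.

Lemma bdB z w A : bd r (fun B => z B - w B) A = bd r z A - bd r w A.
Proof. by rewrite /bd -sumrB; apply: eq_bigr => x _; rewrite mulrBr. Qed.

Lemma bdD z w A : bd r (fun B => z B + w B) A = bd r z A + bd r w A.
Proof. by rewrite /bd -big_split; apply: eq_bigr => x _; rewrite mulrDr. Qed.

Lemma bdZ c z A : bd r (fun B => c * z B) A = c * bd r z A.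
Proof. by rewrite /bd mulr_sumr; apply: eq_bigr => x _; rewrite mulrCA. Qed.

Lemma bd_sum (I : Type) (s : seq I) (P : pred I) (F : I -> {set X} -> rat) A :
  bd r (fun B => \sum_(i <- s | P i) F i B) A = \sum_(i <- s | P i) bd r (F i) A.
Proof.
rewrite /bd exchange_big /=; apply: eq_bigr => x _; exact: mulr_sumr.
Qed.

Lemma eq_bd z w : z =1 w -> bd r z =1 bd r w.
Proof. by move=> zw A; apply: eq_bigr => x _; rewrite zw. Qed.

Lemma supported_bd z K s : is_complex K -> supported z K s.+1 -> supported (bd r z) K s.
Proof.
move=> [_ Kd] zK A; case: (pickP (fun x => (x \notin A) && (z (x |: A) != 0))).
  move=> x /andP[xA /zK[xAK]]; rewrite cardsU1 xA => -[<-] _; split=> //.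
  exact: Kd xAK (subsetUr _ _).
move=> z0; rewrite /bd big1 ?eqxx// => x xA; move: (z0 x); rewrite xA /= => /negbFE/eqP->.
by rewrite mulr0.
Qed.

(** A cycle is filled by the cone over it with apex a vertex [v] of the simplex. *)
Lemma simplex_fillable (S : {set X}) s : S != set0 -> fillable r (powerset S) s.
Proof.
case/set0Pn => v vS z zS dz.
pose w A := if v \in A then inc_sgn r A v * z (A :\ v) else 0.
exists w => [A|A].
  rewrite /w; case: ifP => [vA|]; rewrite ?eqxx// mulf_eq0 negb_or => /andP[_ /zS[]].
  rewrite !powersetE => AS cA; split; last by rewrite (cardsD1 v) vA cA.
  by rewrite -(setD1K vA) subUset sub1set vS.
have [vA|vA] := boolP (v \in A); last first.
  rewrite /bd (bigD1 v) //= big1 => [|x /andP[xA xv]].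
    by rewrite /w setU11 setU1K // inc_sgn_self mulrA inc_sgn_sq mul1r addr0.
  by rewrite /w !inE (negPf vA) eq_sym (negPf xv) mulr0.
(* For [v \in A] the cycle condition at [A :\ v] expresses [z A] by the other simplices over that
   facet, whose cones are exactly the terms of [bd r w A]. *)
pose B := A :\ v; have vB : v \notin B by rewrite !inE eqxx.
have AE : A = v |: B by rewrite setD1K.
have := dz B; rewrite /bd (bigD1 v) //= -AE => /eqP; rewrite addr_eq0 => /eqP zA.
have -> : z A = inc_sgn r B v * (inc_sgn r B v * z A) by rewrite mulrA inc_sgn_sq mul1r.
rewrite zA mulrN mulr_sumr -sumrN; apply: eq_big => [x|x xA].
  by rewrite AE !inE negb_or andbC; case: eqP => // ->; rewrite eqxx ?andbF.
have xv : x != v by apply: contraNneq xA => ->.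
have xB : x \notin B by rewrite !inE (negPf xA) andbF.
rewrite /w !inE vA orbT.
have -> : (x |: A) :\ v = x |: B.
  by apply/setP => y; rewrite !inE; case: (y =P x) => [->|_]; rewrite ?xv ?orbF //= andbC.
rewrite !mulrA -mulNr; congr (_ * _); rewrite AE setUCA inc_sgn_self.
rewrite !inc_sgnU1 //; have : r x != r v by rewrite (inj_eq r_inj).
by case: ltngtP => //= _ _; rewrite ?expr0 ?expr1; ring.
Qed.

Lemma vertex_fillable K v : is_complex K -> [set v] \in K -> fillable r K 0.
Proof.
move=> [K0 _] vK z zK _.
exists (fun A => if A == [set v] then z set0 else 0) => [A|A].
  by case: (A =P [set v]) => [->|]; rewrite ?eqxx // cards1.
have [->|A0] := eqVneq A set0.
  rewrite /bd (bigD1 v) ?inE //= big1 => [|x /andP[_ xv]].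
    rewrite setU0 eqxx addr0 /inc_sgn (_ : [set _ in _ | _] = set0) ?cards0 ?mul1r //.
    by apply/setP => y; rewrite !inE.
  by rewrite setU0 (inj_eq set1_inj) (negPf xv) mulr0.
rewrite /bd big1 => [|x xA]; last first.
  case: eqP => [/setP e|_]; last by rewrite mulr0.
  case/set0Pn: A0 => a aA; have := e a; rewrite !inE aA orbT => /esym/eqP av.
  by have := e x; rewrite !inE eqxx -av /= => /esym/eqP xa; rewrite xa aA in xA.
apply/esym/eqP; apply/negP => /negP/zK[_ /eqP]; rewrite cards_eq0; exact/negP.
Qed.

End BdTheory.

(** Chains become row vectors on which [bd] acts as right multiplication by [bdmx]. The image of one
    boundary lies in the kernel of the next, and the rank equation makes them equal. *)
Lemma hred_fillable (T : finType) (K : {set {set T}}) j : is_complex K ->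
  hred_vanish K j -> fillable (fun x : T => enum_rank x : nat) K j.+1.
Proof.
move=> cK hK z zK dz; pose r (x : T) : nat := enum_rank x.
have rI : injective r by move=> x y /ord_inj/enum_rank_inj.
pose vec s (y : {set T} -> rat) : 'rV[rat]_#|faces K s| := \row_i y (enum_val i).
have bdE s (y : {set T} -> rat) : supported y K s.+1 -> vec s.+1 y *m bdmx K s.+1 = vec s (bd r y).
  move=> yK; apply/rowP => i; rewrite !mxE; set A := enum_val i.
  transitivity (\sum_(B in faces K s.+1) y B * bdcoef B A).
    rewrite [RHS]big_enum_val /=; apply: eq_bigr => k _; rewrite !mxE //.
  transitivity (\sum_(B : {set T}) y B * bdcoef B A).
    rewrite [RHS](bigID (mem (faces K s.+1))) /= [X in _ = _ + X]big1 ?addr0 // => B BK.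
    have [->|/yK[BK' cB]] := eqVneq (y B) 0; first by rewrite mul0r.
    by rewrite inE BK' cB eqxx in BK.
  transitivity (\sum_(B : {set T}) \sum_(v in B | A == B :\ v) y B * inc_sgn r B v).
    apply: eq_bigr => B _; rewrite /bdcoef big_mkcondr mulr_sumr.
    by apply: eq_bigr => v _; case: ifP => _; rewrite ?mulr0.
  rewrite (exchange_big_dep xpredT) //= /bd [RHS]big_mkcond; apply: eq_bigr => v _.
  case: ifPn => vA.
    rewrite (big_pred1 (v |: A)) => [|B].
      by rewrite inc_sgn_self mulrC.
    apply/andP/eqP => [[vB /eqP->]|->]; first by rewrite setD1K.
    by rewrite setU11 setU1K.
  rewrite big1 // => B /andP[vB /eqP AB]; by rewrite AB !inE eqxx in vA.
have eqK s (y1 y2 : {set T} -> rat) A : supported y1 K s -> supported y2 K s ->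
    vec s y1 = vec s y2 -> y1 A = y2 A.
  move=> s1 s2 /rowP e; have [Af|Af] := boolP (A \in faces K s).
    by have := e (enum_rank_in Af A); rewrite !mxE enum_rankK_in.
  have: y1 A == 0 by apply: contraNT Af => /s1[? ?]; rewrite inE; apply/andP; split => //; apply/eqP.
  have: y2 A == 0 by apply: contraNT Af => /s2[? ?]; rewrite inE; apply/andP; split => //; apply/eqP.
  by move=> /eqP-> /eqP->.
have unvec s (a : 'rV[rat]_#|faces K s|) :
    exists2 y, supported y K s & vec s y = a.
  pose y (B : {set T}) := \sum_(i | enum_val i == B) a 0 i.
  exists y => [B|].
    rewrite /y; case: (pickP (fun i : 'I_#|faces K s| => enum_val i == B)) => [i /eqP <- _|i0].
      by have := enum_valP i; rewrite inE => /andP[iK /eqP ic].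
    by rewrite big_pred0 ?eqxx.
  apply/rowP => i; rewrite mxE /y (big_pred1 i) // => k.
  by rewrite (inj_eq enum_val_inj).
have vz0 : vec j.+1 z *m bdmx K j.+1 = 0.
  by rewrite bdE //; apply/rowP => i; rewrite !mxE dz.
have comp0 : bdmx K j.+2 *m bdmx K j.+1 = 0.
  apply/row_matrixP => i; rewrite row_mul row0.
  have [y yK yE] := unvec _ (row i 1%:M : 'rV_#|faces K j.+2|).
  have -> : row i (bdmx K j.+2) = vec j.+1 (bd r y).
    by rewrite -bdE // yE -row_mul mul1mx.
  rewrite bdE; last exact: supported_bd.
  by apply/rowP => k; rewrite !mxE bd_bd.
have : (vec j.+1 z <= bdmx K j.+2)%MS.
  have le : (bdmx K j.+2 <= kermx (bdmx K j.+1))%MS by apply/sub_kermxP.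
  have rk : \rank (bdmx K j.+2) = \rank (kermx (bdmx K j.+1)).
    by rewrite mxrank_ker; move: hK; rewrite /hred_vanish; set a := \rank _; set b := \rank _; lia.
  have [_] := mxrank_leqif_sup le; rewrite rk eqxx => /esym.
  by apply: submx_trans; apply/sub_kermxP.
case/submxP => a; have [w wK <-] := unvec _ a => zE.
exists w => // A; apply: (eqK j.+1) => //; first exact: supported_bd.
by rewrite -bdE // -zE.
Qed.

End Chains.

(** * Acyclic carriers on the cubical grid *)

Section Cubes.
Local Open Scope ring_scope.
Import GRing.Theory Num.Theory.
Variables (I : finType) (rI : I -> nat).
Hypothesis rI_inj : injective rI.

(* Cubes of the integer grid in doubled coordinates: an odd coordinate [2a+1]
   stands for the interval [a, a+1], an even one [2a] for the point [a]. *)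
Definition odds (u : {ffun I -> nat}) : {set I} := [set i | odd (u i)].

Definition upd (u : {ffun I -> nat}) (i : I) (a : nat) : {ffun I -> nat} :=
  [ffun j => if j == i then a else u j].

Lemma updC u i j a b : i != j -> upd (upd u i a) j b = upd (upd u j b) i a.
Proof.
by move=> ij; apply/ffunP => k; rewrite !ffunE; case: (k =P j) => // ->; rewrite eq_sym (negPf ij).
Qed.

Lemma odds_upd u i a : ~~ odd a -> odds (upd u i a) = odds u :\ i.
Proof.
by move=> ea; apply/setP => j; rewrite !inE ffunE; case: eqP => //= _; exact: negbTE.
Qed.

Lemma upd_neq u i j a : j != i -> upd u i a j = u j.
Proof. by rewrite ffunE => /negPf->. Qed.

Implicit Types u : {ffun I -> nat}.
Variables (X : finType) (r : X -> nat).

Definition cube_bd (Phi : {ffun I -> nat} -> {set X} -> rat) u A :=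
  \sum_(i in odds u) inc_sgn rI (odds u) i *
     (Phi (upd u i (u i).+1) A - Phi (upd u i (u i).-1) A).

(** At a grid point the prescribed boundary is the empty simplex, so that the image is a 0-chain of
    augmentation 1. *)
Definition aug_bd Phi u A : rat :=
  if odds u == set0 then (A == set0)%:R else cube_bd Phi u A.

Variables (D : {ffun I -> nat} -> Prop) (L : {ffun I -> nat} -> {set {set X}}).
Hypothesis D_face : forall u i, D u -> odd (u i) ->
  D (upd u i (u i).+1) /\ D (upd u i (u i).-1).
Hypothesis L_cplx : forall u, D u -> is_complex (L u).
Hypothesis L_face : forall u i, D u -> odd (u i) ->
  L (upd u i (u i).+1) \subset L u /\ L (upd u i (u i).-1) \subset L u.
Hypothesis L_fill : forall u, D u -> fillable r (L u) #|odds u|.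

Lemma odds_face u i : odd (u i) ->
  odds (upd u i (u i).+1) = odds u :\ i /\ odds (upd u i (u i).-1) = odds u :\ i.
Proof. by move=> oi; rewrite !odds_upd //; case: (u i) oi => //= k; rewrite ?negbK. Qed.

Lemma card_odds_face u i : odd (u i) ->
  (#|odds (upd u i (u i).+1)|.+1 = #|odds u|) /\ (#|odds (upd u i (u i).-1)|.+1 = #|odds u|).
Proof.
by move=> oi; have [-> ->] := odds_face oi; rewrite (cardsD1 i (odds u)) inE oi.
Qed.

Let chain_map_at Phi u := supported (Phi u) (L u) #|odds u|.+1 /\
  forall A, bd r (Phi u) A = aug_bd Phi u A.

Lemma supported_sub (z : {set X} -> rat) (K K' : {set {set X}}) s :
  K \subset K' -> supported z K s -> supported z K' s.
Proof. by move=> /subsetP KK zK A /zK[/KK]. Qed.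

Lemma supported_aug_bd Phi u : D u ->
  (forall v, D v -> (#|odds v| < #|odds u|)%N -> chain_map_at Phi v) ->
  supported (aug_bd Phi u) (L u) #|odds u|.
Proof.
move=> Du cm A; rewrite /aug_bd; have [->|_] := eqVneq (odds u) set0.
  have [-> _|_] := eqVneq A set0; last by rewrite eqxx.
  by rewrite !cards0; case: (L_cplx Du).
case: (pickP (fun i => (i \in odds u) &&
   ((Phi (upd u i (u i).+1) A != 0) || (Phi (upd u i (u i).-1) A != 0)))).
  move=> i /andP[]; rewrite inE => oi; have [D1 D2] := D_face Du oi.
  have [L1 L2] := L_face Du oi; have [c1 c2] := card_odds_face oi.
  case/orP => /[dup] nz.
    have [|s1 _] := cm _ D1; first by rewrite -c1.
    by move=> /(supported_sub L1 s1); rewrite c1.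
  have [|s1 _] := cm _ D2; first by rewrite -c2.
  by move=> /(supported_sub L2 s1); rewrite c2.
move=> z0; rewrite /cube_bd big1 ?eqxx // => i oi; move: (z0 i); rewrite oi /=.
by move=> /negbT; rewrite negb_or !negbK => /andP[/eqP-> /eqP->]; rewrite subr0 mulr0.
Qed.

(** Since [Phi] is a chain map on smaller cubes, this is the squared cubical boundary, whose terms
    cancel in pairs. *)
Lemma bd_aug_bd Phi u : D u ->
  (forall v, D v -> (#|odds v| < #|odds u|)%N -> chain_map_at Phi v) ->
  forall A, bd r (aug_bd Phi u) A = 0.
Proof.
move=> Du cm A; rewrite /aug_bd; have [e0|/set0Pn[i0 i0u]] := eqVneq (odds u) set0.
  rewrite /bd big1 // => x _; case: eqP => [/setP/(_ x)|_]; last by rewrite mulr0.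
  by rewrite !inE eqxx.
transitivity (\sum_(i in odds u) inc_sgn rI (odds u) i *
   (aug_bd Phi (upd u i (u i).+1) A - aug_bd Phi (upd u i (u i).-1) A)).
  rewrite (bd_sum r _ _ (fun i B => inc_sgn rI (odds u) i *
     (Phi (upd u i (u i).+1) B - Phi (upd u i (u i).-1) B))).
  apply: eq_bigr => i; rewrite inE => oi; rewrite bdZ bdB.
  have [D1 D2] := D_face Du oi; have [c1 c2] := card_odds_face oi.
  have [|_ ->] := cm _ D1; first by rewrite -c1.
  by have [|_ ->] := cm _ D2; first by rewrite -c2.
(* On an edge the cancellation is different: both ends have augmentation 1. *)
have [e1|ne1] := boolP (odds u == [set i0]).
  rewrite big1 // => i; rewrite inE => oi; have [c1 c2] := card_odds_face oi.
  rewrite /aug_bd; have -> : odds (upd u i (u i).+1) == set0.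
    by move: c1; rewrite -cards_eq0 (eqP e1) cards1 => -[->].
  have -> : odds (upd u i (u i).-1) == set0.
    by move: c2; rewrite -cards_eq0 (eqP e1) cards1 => -[->].
  by rewrite subrr mulr0.
have ne i : odd (u i) -> odds u :\ i != set0.
  move=> oi; apply: contraNneq ne1 => e; have oE : odds u = [set i].
    by rewrite -(@setD1K _ i (odds u)) ?inE // e setU0.
  by move: i0u; rewrite oE inE => /eqP ->.
pose S i j a b := inc_sgn rI (odds u) i * inc_sgn rI (odds u :\ i) j * Phi (upd (upd u i a) j b) A.
transitivity (\sum_(i in odds u) \sum_(j | (j \in odds u) && (j != i))
   (S i j (u i).+1 (u j).+1 - S i j (u i).+1 (u j).-1
    - S i j (u i).-1 (u j).+1 + S i j (u i).-1 (u j).-1)).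
  apply: eq_bigr => i; rewrite inE => oi; have [e1 e2] := odds_face oi.
  rewrite /aug_bd e1 e2 (negPf (ne i oi)) /cube_bd e1 e2 -sumrB mulr_sumr.
  apply: eq_big => [j|j]; first by rewrite !inE andbC.
  rewrite !inE => /andP[ji oj]; rewrite /S !upd_neq //; ring.
rewrite sum_antisym // => i j; rewrite !inE => oi oj ij.
rewrite /S !(@updC u j i) 1?eq_sym //.
have -> : inc_sgn rI (odds u) i * inc_sgn rI (odds u :\ i) j
        = - (inc_sgn rI (odds u) j * inc_sgn rI (odds u :\ j) i).
  pose B := odds u :\ i :\ j.
  have iB : i \notin B by rewrite !inE eqxx andbF.
  have jB : j \notin B by rewrite !inE eqxx.
  have ui : odds u :\ i = j |: B by rewrite setD1K // !inE eq_sym ij.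
  have uj : odds u :\ j = i |: B by apply/setP => x; rewrite !inE; case: (x =P i) => [->|_]; rewrite ?ij ?oi.
  rewrite -(inc_sgnD1 rI (odds u) i) -(inc_sgnD1 rI (odds u) j) ui uj.
  rewrite !inc_sgn_self mulrC [X in _ = - X]mulrC.
  by apply: inc_sgn_swap => //; rewrite eq_sym.
ring.
Qed.

(** Induction on the dimension of the cubes: the images of the faces of [u] add up to a cycle
    carried by [L u], which [L_fill] bounds. *)
Lemma acyclic_carrier : exists Phi, forall u, D u ->
  supported (Phi u) (L u) #|odds u|.+1 /\ forall A, bd r (Phi u) A = aug_bd Phi u A.
Proof.
suff step k : exists Phi, forall u, D u -> (#|odds u| < k)%N -> chain_map_at Phi u.
  have [Phi H] := step #|I|.+1; exists Phi => u Du; apply: H => //.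
  by rewrite ltnS max_card.
elim: k => [|k [Phi H]]; first by exists (fun _ _ => 0).
have /choice[W HW] : forall u, exists w, D u -> #|odds u| = k ->
    supported w (L u) k.+1 /\ forall A, bd r w A = aug_bd Phi u A.
  move=> u; have [[Du uk]|nDu] := pselect (D u /\ #|odds u| = k); last first.
    by exists (fun=> 0) => Du uk; case: nDu.
  have cm v : D v -> (#|odds v| < #|odds u|)%N -> chain_map_at Phi v by rewrite uk; apply: H.
  have [w w1 w2] := L_fill Du (supported_aug_bd Du cm) (bd_aug_bd Du cm).
  by exists w => _ _; rewrite -uk.
pose Psi u := if (#|odds u| < k)%N then Phi u else W u.
have PsiE u A : D u -> (#|odds u| <= k)%N -> aug_bd Psi u A = aug_bd Phi u A.
  move=> Du uk; rewrite /aug_bd; case: eqP => // _; apply: eq_bigr => i.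
  rewrite inE => oi; have [c1 c2] := card_odds_face oi.
  by rewrite /Psi c1 c2 uk.
exists Psi => u Du; rewrite ltnS => uk; rewrite /chain_map_at /Psi.
case: ltnP => [lt|ge].
  by have [? e] := H _ Du lt; split=> // A; rewrite PsiE.
have /eqP ek : #|odds u| == k by rewrite eqn_leq uk.
by have [s e] := HW u Du ek; rewrite ek; split=> // A; rewrite PsiE.
Qed.

End Cubes.

(** * From the fine grid to the faces of the unit cube *)

Section Cells.
Local Open Scope ring_scope.
Import GRing.Theory Num.Theory.
Variables (I : finType) (rI : I -> nat) (X : finType) (r : X -> nat).
Implicit Types A B : {set I}.

(* The pair [(A, B)] stands for the face of the unit cube whose free coordinates
   are those in [A], those in [B] being 1 and all the others 0. *)
Definition cell_chain_map (dom : {set I} -> bool)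
    (K : {set I} -> {set I} -> {set {set X}}) (M : {set I} -> {set I} -> {set X} -> rat) :=
  forall A B, dom B -> [disjoint A & B] -> supported (M A B) (K A B) #|A|.+1 /\
  forall S, bd r (M A B) S = if A == set0 then (S == set0)%:R else
    \sum_(i in A) inc_sgn rI A i * (M (A :\ i) (i |: B) S - M (A :\ i) B S).

(** A small cube of the face [(A, B)] cut into [N] intervals per direction, in doubled coordinates;
    only the values of [q] on [A] matter. *)
Definition grid_cube N A B (q : {ffun I -> 'I_N}) : {ffun I -> nat} :=
  [ffun i => if i \in A then (q i).*2.+1 else if i \in B then N.*2 else 0%N].

Lemma odds_grid_cube N A B q : odds (@grid_cube N A B q) = A.
Proof.
apply/setP => i; rewrite !inE ffunE; case: ifP => _; first by rewrite /= odd_double.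
by case: ifP; rewrite ?odd_double.
Qed.

(** Swapping the value at [i] with the new value is an involution on the pairs. The lemma singles
    out one direction of a sum over grid cubes. *)
Lemma sum_ffun_upd N (F : {ffun I -> 'I_N} -> rat) (i : I) :
  \sum_(q : {ffun I -> 'I_N}) \sum_(a : 'I_N) F [ffun j => if j == i then a else q j] = N%:R * \sum_q F q.
Proof.
rewrite (pair_bigA _ (fun (q : {ffun I -> 'I_N}) (a : 'I_N) => F [ffun j => if j == i then a else q j])) /=.
pose h (p : {ffun I -> 'I_N} * 'I_N) :=
  ([ffun j => if j == i then p.2 else p.1 j], p.1 i).
have hK : involutive h.
  case=> q a; rewrite /h /=; congr pair; last by rewrite ffunE eqxx.
  by apply/ffunP => j; rewrite !ffunE; case: eqP => [->|].
rewrite (reindex_inj (inv_inj hK)) /=.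
transitivity (\sum_(p : {ffun I -> 'I_N} * 'I_N) F p.1).
  apply: eq_bigr => -[q a] _ /=; congr F.
  by apply/ffunP => j; rewrite !ffunE; case: eqP => [->|].
rewrite -(pair_bigA _ (fun q (a : 'I_N) => F q)) /= mulr_sumr; apply: eq_bigr => q _.
by rewrite sumr_const card_ord mulr_natl.
Qed.

(** The image of a face is the sum of the images of its small cubes. In each direction the inner
    walls telescope, leaving the two opposite facets. *)
Lemma cell_chains_of_grid N Phi (dom : {set I} -> bool) K : (0 < N)%N ->
  (forall A B, dom B -> [disjoint A & B] -> forall q : {ffun I -> 'I_N},
     supported (Phi (grid_cube A B q)) (K A B) #|A|.+1 /\
     forall S, bd r (Phi (grid_cube A B q)) S = aug_bd rI Phi (grid_cube A B q) S) ->
  exists M, cell_chain_map dom K M.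
Proof.
move=> N0 H; have N0' : N%:R != 0 :> rat by rewrite pnatr_eq0 -lt0n.
(* The sum ranges over all [q], including the irrelevant coordinates outside [A]:
   hence the normalization. *)
pose M A B S := N%:R ^+ #|A| / N%:R ^+ #|I| * \sum_(q : {ffun I -> 'I_N}) Phi (grid_cube A B q) S.
exists M => A B dB dAB; split=> [S|S].
  case: (pickP (fun q : {ffun I -> 'I_N} => Phi (grid_cube A B q) S != 0)) => [q nz _|z].
    exact: (H A B dB dAB q).1 nz.
  by rewrite /M big1 ?mulr0 ?eqxx // => q _; apply/eqP/negbFE/z.
rewrite /M bdZ bd_sum.
under eq_bigr => q _ do rewrite (H A B dB dAB q).2 /aug_bd odds_grid_cube.
have [A0|A0] := eqVneq A set0.
  rewrite sumr_const card_ffun card_ord A0 cards0 expr0 -[_ *+ (_ ^ _)]mulr_natl natrX.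
  by rewrite mul1r mulrA mulVf ?mul1r // expf_neq0.
under eq_bigr => q _ do rewrite /cube_bd odds_grid_cube.
rewrite exchange_big mulr_sumr /=; apply: eq_bigr => i iA.
have iB : i \notin B by rewrite (disjointFr dAB).
rewrite -mulr_sumr mulrCA; congr (_ * _).
rewrite -mulrBr -sumrB (cardsD1 i A) iA exprS -!mulrA mulrCA; congr (_ * _).
rewrite mulrCA; congr (_ * _).
(* [g a q] is the image of the wall at height [a] orthogonal to direction [i]. *)
pose g (a : nat) (q : {ffun I -> 'I_N}) := Phi (upd (grid_cube A B q) i a.*2) S.
have gE a b (q : {ffun I -> 'I_N}) : g b [ffun j => if j == i then a else q j] = g b q.
  rewrite /g; congr (Phi _ S); apply/ffunP => j; rewrite !ffunE.
  by case: eqP => // _; rewrite ffunE.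
transitivity (N%:R * \sum_(q : {ffun I -> 'I_N}) (g (q i).+1 q - g (q i) q)).
  congr (_ * _); apply: eq_bigr => q _; rewrite /g ffunE iA.
  by rewrite doubleS.
rewrite -(sum_ffun_upd _ i); apply: eq_bigr => q _.
transitivity (g N q - g 0%N q); last first.
  congr (_ - _); rewrite /g; congr (Phi _ S); apply/ffunP => j; rewrite !ffunE !inE;
   by case: (j =P i) => [->|] //=; rewrite (negPf iB).
rewrite -(telescope_sumr (fun a => g a q) (leq0n N)) big_mkord.
by apply: eq_bigr => a _; rewrite !gE ffunE eqxx.
Qed.

End Cells.

(** * The degree of a coloured chain map *)

Section Colors.
Local Open Scope ring_scope.
Import GRing.Theory Num.Theory.
Variables (X : finType) (r : X -> nat).
Hypothesis r_inj : injective r.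
Variables (n : nat) (col : X -> 'I_n).
Implicit Types (S : {set X}) (B I : {set 'I_n}) (z w : {set X} -> rat).

Let rk (i : 'I_n) : nat := i.
Let rk_inj : injective rk. Proof. exact: ord_inj. Qed.

Definition rainbow S := #|col @: S| == #|S|.

(* The sign of the permutation sorting [S] by colour. *)
Definition inv_sgn S : rat :=
  \prod_(u in S) \prod_(v in S) (-1) ^+ ((r u < r v)%N && (col v < col u)%N).

(** The chain map induced by [col] into the full simplex on the colours; simplices with a repeated
    colour go to 0. *)
Definition col_chain z B : rat :=
  \sum_(S : {set X} | rainbow S && (col @: S == B)) inv_sgn S * z S.

Lemma inc_sgn_prod (Y : finType) (rY : Y -> nat) (A : {set Y}) y :
  inc_sgn rY A y = \prod_(x in A) (-1) ^+ (rY x < rY y)%N.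
Proof.
rewrite prodrXr; congr (_ ^+ _); rewrite -sum1_card big_mkcond [RHS]big_mkcond /=.
by apply: eq_bigr => x _; rewrite inE; case: (x \in A); case: ltnP.
Qed.

(** The position of [v] by rank is compared with its position by colour. The last product records
    colour ties: it is trivial on rainbow sets and gives the opposite signs when one colour occurs
    twice. *)
Lemma inv_sgnU1 S v : v \notin S -> inv_sgn S * inc_sgn r S v = inv_sgn (v |: S) *
  (\prod_(u in S) (-1) ^+ (col u < col v)%N *
   \prod_(u in S) (-1) ^+ ((r u < r v)%N && (col u == col v))).
Proof.
move=> vS; rewrite /inv_sgn big_setU1 //= big_setU1 //= ltnn mul1r.
under [X in _ = _ * X * _]eq_bigr => u _ do rewrite big_setU1 //=.
rewrite big_split /= inc_sgn_prod.
set Q := (X in _ = X * (_ * _) * _); set P := (X in _ = Q * (X * _) * _).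
set J := (X in X * _ = _); set P1 := (X in _ = _ * (X * _)); set P2 := (X in _ = _ * (_ * X)).
have -> : Q * (P * J) * (P1 * P2) = J * ((Q * P) * (P1 * P2)) by ring.
congr (_ * _); rewrite -!big_split /=; apply: eq_bigr => u uS.
have : r u != r v by rewrite (inj_eq r_inj); apply: contraNneq vS => <-.
rewrite -(inj_eq rk_inj) /rk /=.
by case: (ltngtP (r u)); case: (ltngtP (col u)) => //= *; rewrite ?expr0 ?expr1; ring.
Qed.

Lemma sub_rainbow S S' : S' \subset S -> rainbow S -> rainbow S'.
Proof.
move=> /subsetP SS /imset_injP inj; apply/imset_injP => x y /SS xS /SS yS; exact: inj.
Qed.

Lemma eq_col_chain z w B : (forall S, rainbow S -> z S = w S) -> col_chain z B = col_chain w B.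
Proof. by move=> zw; apply: eq_bigr => S /andP[rS _]; rewrite zw. Qed.

Lemma col_chainB z w B : col_chain (fun S => z S - w S) B = col_chain z B - col_chain w B.
Proof. by rewrite /col_chain -sumrB; apply: eq_bigr => S _; rewrite mulrBr. Qed.

Lemma col_chainD z w B : col_chain (fun S => z S + w S) B = col_chain z B + col_chain w B.
Proof. by rewrite /col_chain -big_split; apply: eq_bigr => S _; rewrite mulrDr. Qed.

Lemma col_chainZ c z B : col_chain (fun S => c * z S) B = c * col_chain z B.
Proof. by rewrite /col_chain mulr_sumr; apply: eq_bigr => S _; rewrite mulrCA. Qed.

Lemma col_chain_sum (J : Type) (s : seq J) (P : pred J) (F : J -> {set X} -> rat) B :
  col_chain (fun S => \sum_(j <- s | P j) F j S) B = \sum_(j <- s | P j) col_chain (F j) B.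
Proof.
rewrite /col_chain exchange_big /=; apply: eq_bigr => S _; exact: mulr_sumr.
Qed.

Let col_setD1 (S : {set X}) v : v \in S -> col @: S = col v |: col @: (S :\ v).
Proof. by move=> vS; rewrite -imsetU1 setD1K. Qed.

(** The two sides are the coefficients of [z S] in [col_chain (bd r z) B] and in
    [bd rk (col_chain z) B]. If [S] is rainbow, its facets correspond to the removed colours;
    otherwise the rainbow facets with colour set [B], if any, are two and cancel. *)
Lemma col_bd_coef S B :
  \sum_(v in S | rainbow (S :\ v) && (col @: (S :\ v) == B))
     inv_sgn (S :\ v) * inc_sgn r (S :\ v) v
  = \sum_(i | (i \notin B) && (rainbow S && (col @: S == i |: B)))
     inc_sgn rk B i * inv_sgn S.
Proof.
have [rS|nrS] := boolP (rainbow S); last first.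
  rewrite [RHS]big_pred0 => [|i]; last by rewrite andbF.
  case: (pickP (fun v => (v \in S) && (rainbow (S :\ v) && (col @: (S :\ v) == B)))) => [v|z];
    last by rewrite big_pred0.
  case/andP => vS /andP[rv cv].
  have /imsetP[w wS vw] : col v \in col @: (S :\ v).
    apply: contraNT nrS => nv; rewrite /rainbow (col_setD1 vS) cardsU1 nv (eqP rv).
    by rewrite [X in _ == X](cardsD1 v) vS.
  have [wv wS'] : w != v /\ w \in S by move: wS; rewrite !inE => /andP[].
  have injv : {in S :\ v &, injective col} by apply/imset_injP.
  have vwS : v \in S :\ w by rewrite !inE eq_sym wv.
  pose R := S :\ v :\ w.
  have RE : R = S :\ w :\ v by apply/setP => x; rewrite !inE andbCA.
  have Sv : S :\ v = w |: R by rewrite setD1K.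
  have Sw : S :\ w = v |: R by rewrite RE setD1K.
  have wR : w \notin R by rewrite !inE eqxx.
  have vR : v \notin R by rewrite !inE eqxx andbF.
  have ncR u : u \in R -> col u != col w.
    rewrite inE => /andP[uw uS]; rewrite inE in uw; apply: contraNneq uw => e.
    by apply/eqP/injv.
  have rw : rainbow (S :\ w).
    rewrite /rainbow Sw imsetU1 vw -imsetU1 -Sv (eqP rv) Sv.
    by rewrite !cardsU1 wR vR.
  have cw : col @: (S :\ w) == B by rewrite Sw imsetU1 vw -imsetU1 -Sv.
  (* Only [v] and [w], which have the same colour, contribute, with opposite signs. *)
  rewrite (bigD1 v) /=; last by rewrite vS rv cv.
  rewrite (bigD1 w) /=; last by rewrite wS' rw cw wv.
  rewrite big1 ?addr0 => [|u]; last first.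
    case/andP => /andP[/andP[uS /andP[ru _]] uv] uw.
    have /imset_injP inju := ru; have := inju v w; rewrite !inE vS wS' !(eq_sym _ u) uv uw.
    by move=> /(_ isT isT vw) e; rewrite e eqxx in wv.
  have vS1 : v \notin S :\ v by rewrite !inE eqxx.
  have wS1 : w \notin S :\ w by rewrite !inE eqxx.
  rewrite !inv_sgnU1 // !setD1K // -mulrDr Sv Sw !big_setU1 //= vw ltnn.
  have P2 y : \prod_(u in R) (-1) ^+ ((r u < r y)%N && (col u == col w)) = 1 :> rat.
    by apply: big1 => u /ncR/negPf->; rewrite andbF.
  rewrite !P2 eqxx !andbT !mulr1 !mul1r; have := wv; rewrite -(inj_eq r_inj).
  by case: ltngtP => //= _ _; rewrite ?expr0 ?expr1; ring.
have injS : {in S &, injective col} by apply/imset_injP.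
case: (pickP (fun v => (v \in S) && (rainbow (S :\ v) && (col @: (S :\ v) == B)))) => [v|z].
  case/andP => vS /andP[rv /eqP cv].
  have cvB : col v \notin B.
    rewrite -cv; apply/imsetP => -[w]; rewrite !inE => /andP[wv wS] e.
    by move: wv; rewrite (injS _ _ _ _ e) ?eqxx.
  have cS : col @: S = col v |: B by rewrite (col_setD1 vS) cv.
  rewrite (big_pred1 v) => [|w]; last first.
    apply/andP/eqP => [[wS /andP[_ /eqP cw]]|->]; last by rewrite vS rv cv eqxx.
    apply/eqP; apply: contraNT cvB => wv; rewrite -cw; apply/imsetP; exists v => //.
    by rewrite !inE eq_sym wv.
  rewrite (big_pred1 (col v)) => [|i]; last first.
    apply/andP/eqP => [[iB /eqP e]|->]; last by rewrite cvB cS eqxx.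
    by move: e; rewrite cS => /setP/(_ i); rewrite !inE eqxx (negPf iB) orbF => /eqP.
  rewrite inv_sgnU1 ?setD1K //; last by rewrite !inE eqxx.
  rewrite mulrC; congr (_ * _); rewrite [X in _ * X]big1 => [|u].
    rewrite mulr1 -cv inc_sgn_prod big_imset //= => x y /setD1P[_ xS] /setD1P[_ yS]; exact: injS.
  case/setD1P => uv uS; case: eqP => [e|_]; last by rewrite andbF.
  by move: uv; rewrite (injS _ _ _ _ e) ?eqxx.
rewrite big_pred0 // [RHS]big_pred0 // => i; apply/negP => /andP[iB /eqP cS].
have /imsetP[v vS iv] : i \in col @: S by rewrite cS setU11.
have := z v; rewrite vS (sub_rainbow _ rS) ?subD1set //= => /negP; apply.
apply/eqP; apply/setP => j; apply/imsetP/idP => [[w /setD1P[wv wS] ->]|jB].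
  have : col w \in col @: S by apply: imset_f.
  rewrite cS !inE => /orP[/eqP e|//].
  by move: wv; rewrite (injS w v) ?eqxx // -?iv.
have /imsetP[w wS jw] : j \in col @: S by rewrite cS setU1r.
exists w => //; rewrite !inE wS andbT; apply: contraNneq iB => wv.
by rewrite iv -wv -jw.
Qed.

Lemma col_chain_bd z B : bd rk (col_chain z) B = col_chain (bd r z) B.
Proof.
transitivity (\sum_S z S * \sum_(i | (i \notin B) && (rainbow S && (col @: S == i |: B)))
     inc_sgn rk B i * inv_sgn S).
  rewrite /bd /col_chain; under eq_bigr => i _ do rewrite mulr_sumr.
  rewrite (exchange_big_dep xpredT) //=; apply: eq_bigr => S _.
  rewrite mulr_sumr; apply: eq_bigr => i _; ring.
under eq_bigr => S _ do rewrite -col_bd_coef mulr_sumr.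
rewrite /col_chain /bd; under [RHS]eq_bigr => S _ do rewrite mulr_sumr.
rewrite (exchange_big_dep xpredT) //= [RHS](exchange_big_dep xpredT) //=.
apply: eq_bigr => v _.
rewrite [RHS](reindex_onto (fun S => S :\ v) (fun S => v |: S)) /=; last first.
  by move=> S /andP[_ vS]; rewrite setU1K.
apply: eq_big => [S|S /andP[vS _]]; last by rewrite setD1K //; ring.
rewrite !inE eqxx /= andbT andbC; congr (_ && _).
by apply/idP/eqP => [/setD1K //|<-]; rewrite setU11.
Qed.

Lemma sum_add_elt j (G : 'I_n -> {set 'I_n} -> rat) :
  \sum_(I : {set 'I_n} | #|I| == j) \sum_(i | i \notin I) G i (i |: I) =
  \sum_(I : {set 'I_n} | #|I| == j.+1) \sum_(i in I) G i I.
Proof.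
rewrite (exchange_big_dep xpredT) //= [RHS](exchange_big_dep xpredT) //=.
apply: eq_bigr => i _.
rewrite [RHS](reindex_onto (fun I => i |: I) (fun I => I :\ i)) /=; last first.
  by move=> I /andP[_ iI]; rewrite setD1K.
apply: eq_bigl => I; rewrite setU11 andbT cardsU1.
have [iI|iI] := boolP (i \in I); last by rewrite setU1K // eqxx.
rewrite andbF; apply/esym/negbTE/nandP; right; apply/eqP => e.
by move: iI; rewrite -e !inE eqxx.
Qed.

Variable d : nat.

(** * The degree is one *)

Section Degree.
Variables (Z : {set 'I_n} -> {set X} -> rat) (E : {set 'I_n} -> 'I_n -> {set X} -> rat).
Hypothesis bdZE : forall I, (d < #|I|)%N -> forall S, bd r (Z I) S =
  if I == setT then (S == set0)%:R else
  \sum_(i | i \notin I) inc_sgn rk (~: I) i * (Z (i |: I) S - E I i S).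
Hypothesis EP : forall I i S, (d < #|I|)%N -> i \notin I -> E I i S != 0 -> i \notin col @: S.

(** Applied to [E I i], which stands for the facet of [Q_I] where coordinate [i] is 0: it misses
    colour [i], so it does not contribute to the degree. *)
Lemma col_chain_avoid z B i : i \in B -> (forall S, z S != 0 -> i \notin col @: S) ->
  col_chain z B = 0.
Proof.
move=> iB zi; apply: big1 => S /andP[_ /eqP cS]; have [->|/zi] := eqVneq (z S) 0.
  by rewrite mulr0.
by rewrite cS iB.
Qed.

(* Stokes: pushing the boundary inside trades the cells with [j] coordinates equal
   to 1 for those with [j + 1] such coordinates, down to the vertex [(1, ..., 1)]. *)
Lemma col_degree_eq1 j : (d < j <= n)%N ->
  \sum_(I : {set 'I_n} | #|I| == j) bd rk (col_chain (Z I)) (~: I) = 1.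
Proof.
move=> /andP[dj jn]; have [m jE] : exists m, m = (n - j)%N by exists (n - j)%N.
elim: m j dj jn jE => [|m IH] j dj jn jE.
  have {jE jn} jn : j = n by lia.
  rewrite jn in dj *.
  rewrite (big_pred1 setT) => [|I]; last first.
    rewrite /= eqEcard subsetT cardsT card_ord /=.
    by have := max_card (mem I); rewrite card_ord eqn_leq => ->.
  rewrite setCT; have dn : (d < #|[set: 'I_n]|)%N by rewrite cardsT card_ord.
  rewrite col_chain_bd /col_chain (big_pred1 set0) => [|S].
    rewrite bdZE // !eqxx mulr1 /inv_sgn big_set0 //.
  apply/andP/eqP => [[_]|->]; last by rewrite /rainbow imset0 !cards0 !eqxx.
  by rewrite imset_eq0 => /eqP.
have jn' : (j < n)%N by lia.
rewrite -(IH j.+1) // ?ltnS 1?ltnW //; last by rewrite subnS -jE.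
transitivity (\sum_(I : {set 'I_n} | #|I| == j) \sum_(i | i \notin I)
    inc_sgn rk (~: (i |: I)) i * col_chain (Z (i |: I)) (i |: ~: (i |: I))).
  apply: eq_bigr => I /eqP Ij; rewrite col_chain_bd.
  have dI : (d < #|I|)%N by rewrite Ij.
  rewrite (eq_col_chain (w := fun S => \sum_(i | i \notin I)
     inc_sgn rk (~: I) i * (Z (i |: I) S - E I i S))) => [|S _]; last first.
    rewrite bdZE //; case: eqP => // IT; move: Ij; rewrite IT cardsT card_ord; lia.
  rewrite col_chain_sum; apply: eq_bigr => i iI.
  rewrite col_chainZ col_chainB (@col_chain_avoid (E I i) _ i) ?inE //; last by move=> S; apply: EP.
  rewrite subr0; have -> : ~: I = i |: ~: (i |: I).
    by apply/setP => x; rewrite !inE; case: eqP => [->|] //=; rewrite (negPf iI).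
  by rewrite inc_sgn_self.
rewrite (sum_add_elt _ (fun i I => inc_sgn rk (~: I) i * col_chain (Z I) (i |: ~: I))).
by apply: eq_bigr => I _; apply: eq_bigl => i; rewrite inE negbK.
Qed.


End Degree.

(** * Independence of time *)

Section Invariance.
Variables (C : {set {set X}}) (P : pred {set X}).
Variables (Z0 Z1 H : {set 'I_n} -> {set X} -> rat) (E : {set 'I_n} -> 'I_n -> {set X} -> rat).
Hypothesis P_cst : forall S u v, S \in C -> #|S| = (n - d).+1 -> u \in S -> v \in S ->
  rainbow (S :\ u) -> rainbow (S :\ v) -> P (S :\ u) = P (S :\ v).
Hypothesis HC : forall I, #|I| = d.+1 -> supported (H I) C (n - d).+1.
Hypothesis bdHE : forall I, #|I| = d.+1 -> forall S, bd r (H I) S =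
  (-1) ^+ (n - d.+1) * (Z1 I S - Z0 I S) +
  \sum_(i | i \notin I) inc_sgn rk (~: I) i * (H (i |: I) S - E I i S).
Hypothesis EP : forall I i S, #|I| = d.+1 -> i \notin I -> E I i S != 0 -> i \notin col @: S.

Let wt (z : {set X} -> rat) S := (P S)%:R * z S.

(** By [P_cst] the rainbow facets of a simplex of [H I] all satisfy [P] or all fail it. Hence, up to
    non-rainbow terms, keeping the [P]-part of the boundary amounts to taking the boundary of the
    part of [H I] selected by [Q]. *)
Lemma col_chain_wt_bd I B : #|I| = d.+1 ->
  bd rk (col_chain (wt (bd r (H I)))) B = 0.
Proof.
move=> dI; pose Q S := [exists v in S, rainbow (S :\ v) && P (S :\ v)].
have e : col_chain (wt (bd r (H I))) =1 bd rk (col_chain (fun S => (Q S)%:R * H I S)); last first.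
  by rewrite (eq_bd _ e) bd_bd.
move=> B'; rewrite col_chain_bd; apply: eq_col_chain => S rS.
rewrite /wt /bd mulr_sumr; apply: eq_bigr => v vS; rewrite mulrCA; congr (_ * _).
have [->|/(HC dI)[SC cS]] := eqVneq (H I (v |: S)) 0; first by rewrite !mulr0.
congr ((_ : bool)%:R * _); apply/idP/existsP => [PS|[u /and3P[uS ru Pu]]].
  by exists v; rewrite setU11 setU1K // rS.
by rewrite -(setU1K vS) -(P_cst SC cS uS) // ?setU11 // setU1K.
Qed.

(** The boundary of the prism over [Q_I] turns the difference of the two degrees into terms from the
    prisms over [Q_(i |: I)]. Regrouped over the sets with [d + 2] elements, these are values of a
    squared boundary. *)
Lemma degree_invariant :
  \sum_(I : {set 'I_n} | #|I| == d.+1) bd rk (col_chain (wt (Z0 I))) (~: I) =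
  \sum_(I : {set 'I_n} | #|I| == d.+1) bd rk (col_chain (wt (Z1 I))) (~: I).
Proof.
apply/esym/eqP; rewrite -subr_eq0 -sumrB.
have sgn_neq0 : (-1) ^+ (n - d.+1) != 0 :> rat by rewrite signr_eq0.
rewrite -(mulrI_eq0 _ (mulfI sgn_neq0)) mulr_sumr.
pose G i I := inc_sgn rk (~: I) i * bd rk (col_chain (wt (H I))) (i |: ~: I).
have step I : #|I| == d.+1 ->
   (-1) ^+ (n - d.+1) * (bd rk (col_chain (wt (Z1 I))) (~: I) - bd rk (col_chain (wt (Z0 I))) (~: I))
   = - \sum_(i | i \notin I) G i (i |: I).
  move=> /eqP dI; apply/eqP; rewrite -addr_eq0; apply/eqP.
  apply: etrans (col_chain_wt_bd (~: I) dI).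
  have cE B : col_chain (wt (bd r (H I))) B =
      (-1) ^+ (n - d.+1) * (col_chain (wt (Z1 I)) B - col_chain (wt (Z0 I)) B) +
      \sum_(i | i \notin I) inc_sgn rk (~: I) i *
         (col_chain (wt (H (i |: I))) B - col_chain (wt (E I i)) B).
    rewrite -col_chainB -col_chainZ.
    under eq_bigr => i _ do rewrite -col_chainB -col_chainZ.
    rewrite -col_chain_sum -col_chainD; apply: eq_col_chain => S _.
    rewrite /wt bdHE // mulrDr mulr_sumr; congr (_ + _); first by ring.
    by apply: eq_bigr => i _; ring.
  rewrite (eq_bd _ cE) bdD bdZ bdB; congr (_ + _); rewrite bd_sum; apply: eq_bigr => i iI.
  rewrite bdZ bdB [X in _ - X]/bd big1 ?subr0 => [|x xI]; last first.
    rewrite (@col_chain_avoid _ _ i) ?mulr0 // ?inE ?iI ?orbT // => S.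
    by rewrite mulf_eq0 negb_or => /andP[_]; apply: EP.
  have -> : ~: I = i |: ~: (i |: I).
    by apply/setP => x; rewrite !inE; case: eqP => [->|] //=; rewrite (negPf iI).
  by rewrite /G inc_sgn_self.
under eq_bigr => I dI do rewrite step //.
rewrite sumrN (sum_add_elt _ G) oppr_eq0 big1 // => I _.
rewrite -[RHS](bd_bd rk_inj (col_chain (wt (H I))) (~: I)).
by apply: eq_bigl => i; rewrite inE negbK.
Qed.

End Invariance.
End Colors.

(** * Continuous maps on cells of a cube *)

Section ContOn.
Local Open Scope ring_scope.
Import Order.TTheory GRing.Theory Num.Theory numFieldNormedType.Exports.
Local Notation R := Rdefinitions.R.

(** An epsilon-delta form of continuity within [S], suited to gluing maps given on finitely many
    closed cells. *)
Definition cont_on m p (S : 'rV[R]_m -> Prop) (f : 'rV[R]_m -> 'rV[R]_p) :=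
  forall x, S x -> forall e : R, 0 < e ->
  exists2 dl : R, 0 < dl & forall y, S y -> `|x - y| < dl -> `|f x - f y| < e.

Lemma within_cont_on m p (S : 'rV[R]_m -> Prop) (f : 'rV[R]_m -> 'rV[R]_p) :
  {within S, continuous f}%classic <-> cont_on S f.
Proof.
split.
  move=> /subspace_continuousP fc x Sx e e0; have /cvgrPdist_lt /(_ e e0) := fc x Sx.
  move=> nH; have [dl dl0 H] := iffLR (nbhs_normP x (fun y => S y -> `|f x - f y| < e)) nH.
  by exists dl => // y Sy xy; exact: H.
move=> fc; apply/subspace_continuousP => x Sx; apply/cvgrPdist_lt => e e0.
have [dl dl0 H] := fc x Sx e e0.
apply: (iffRL (nbhs_normP x (fun y => S y -> `|f x - f y| < e))).
by exists dl => // y xy Sy; apply: H.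
Qed.

Lemma rV_norm_le m (x : 'rV[R]_m) (e : R) : 0 <= e ->
  `|x| <= e <-> forall i, `|x ord0 i| <= e.
Proof.
move=> e0; rewrite [`|x|]mx_normrE; split => [/bigmax_leP[_ H] i|H].
  exact: (H (ord0, i)).
by apply/bigmax_leP; split => // -[i j] _ /=; rewrite (ord1 i).
Qed.

Lemma rV_norm_lt m (x : 'rV[R]_m) (e : R) : 0 < e ->
  `|x| < e <-> forall i, `|x ord0 i| < e.
Proof.
move=> e0; rewrite [`|x|]mx_normrE; split => [/bigmax_ltP[_ H] i|H].
  exact: (H (ord0, i)).
by apply/bigmax_ltP; split => // -[i j] _ /=; rewrite (ord1 i).
Qed.

Lemma coord_le_norm m (x : 'rV[R]_m) i : `|x ord0 i| <= `|x|.
Proof. by move: i; apply/rV_norm_le. Qed.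

Lemma common_radius (K : finType) (P : K -> R -> Prop) :
  (forall k d d', d' <= d -> P k d -> P k d') ->
  (forall k, exists2 d, 0 < d & P k d) -> exists2 d, 0 < d & forall k, P k d.
Proof.
move=> mono /= H; have /choice[f Hf] : forall k, exists d, 0 < d /\ P k d.
  by move=> k; have [d] := H k; exists d.
exists (\big[Order.min/1]_k f k); first by apply: lt_bigmin => // k _; apply: (Hf k).1.
by move=> k; apply: (mono _ (f k)); [exact: bigmin_le|exact: (Hf k).2].
Qed.

(** Uniform continuity on a compact set, obtained from the near-covering form of compactness with
    radius [N.+1%:R^-1] as the parameter. *)
Lemma cont_on_uniform m p (S : 'rV[R]_m -> Prop) (f : 'rV[R]_m -> 'rV[R]_p) (e : R) :
  0 < e -> compact (S : set 'rV[R]_m) -> cont_on S f ->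
  exists2 N : nat, (0 < N)%N & forall x y, S x -> S y -> `|x - y| <= N%:R^-1 ->
    `|f x - f y| < e.
Proof.
move=> e0 /compact_near_coveringP cS fc.
have := cS nat \oo%classic (fun N x => S x -> forall y, S y -> `|x - y| <= N.+1%:R^-1 -> `|f x - f y| < e) _ _.
case=> [x Sx|N0 _ H]; last first.
  exists N0.+1 => // x y Sx Sy; exact: (H N0 (leqnn _) x Sx Sx).
have e2 : 0 < e / 2 by rewrite divr_gt0.
have [dl dl0 H] := fc x Sx _ e2.
have dl2 : 0 < dl / 2 by rewrite divr_gt0.
exists ([set y | `|x - y| < dl / 2]%classic, [set N | N.+1%:R^-1 < dl / 2]%classic).
  split => /=; last exact: (near_infty_natSinv_lt (PosNum dl2)).
  by apply: (iffRL (nbhs_normP x (fun y => `|x - y| < dl / 2))); exists (dl / 2).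
case=> x' N /= [xx' N_lt] Sx' y Sy x'y.
have /H - /(_ Sx') fx : `|x - x'| < dl by apply: lt_trans xx' _; lra.
have xy : `|x - y| < dl.
  rewrite -(subrKA x') (le_lt_trans (ler_normD _ _)) //.
  by have := le_lt_trans x'y N_lt; move: xx'; lra.
have {}fy := H y Sy xy.
rewrite -(subrKA (f x)) (le_lt_trans (ler_normD _ _)) // distrC.
by move: fx fy; lra.
Qed.

End ContOn.

(** * Contractibility of simplices *)

Section Homotopy.
Local Open Scope ring_scope.
Import Order.TTheory GRing.Theory Num.Theory numFieldNormedType.Exports.
Local Notation R := Rdefinitions.R.
Variable T : finType.

Lemma realization_norm (K : {set {set T}}) x : realization K x -> `|x| <= 1.
Proof.
case=> x0 [x1 _]; apply/rV_norm_le => // i; rewrite ger0_norm ?x0 // -x1.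
by rewrite (bigD1 i) //= lerDl sumr_ge0.
Qed.

Lemma realization_sub (K K' : {set {set T}}) x : K \subset K' ->
  realization K x -> realization K' x.
Proof. by move=> /subsetP KK [x0 [x1 xK]]; split=> //; split=> //; exact: KK. Qed.

Definition vertex_pt (v : T) : 'rV[R]_#|T| := \row_i (i == enum_rank v)%:R.

Lemma realization_vertex (K : {set {set T}}) v : [set v] \in K -> realization K (vertex_pt v).
Proof.
move=> vK; split=> [i|]; first by rewrite mxE ler0n.
split.
  rewrite (bigD1 (enum_rank v)) //= mxE eqxx big1 ?addr0 // => i /negPf iv.
  by rewrite mxE iv.
rewrite (_ : finset _ = [set v]) //; apply/setP => w; rewrite !inE mxE ltr0n lt0b.
by rewrite (inj_eq enum_rank_inj).
Qed.

Lemma realization_segment (S : {set T}) x y (t : R) : 0 <= t <= 1 ->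
  realization (powerset S) x -> realization (powerset S) y ->
  realization (powerset S) ((1 - t) *: x + t *: y).
Proof.
move=> /andP[t0 t1] [x0 [x1 xS]] [y0 [y1 yS]].
have t1' : 0 <= 1 - t by rewrite subr_ge0.
split=> [i|]; first by rewrite !mxE addr_ge0 // mulr_ge0.
split.
  under eq_bigr => i _ do rewrite !mxE.
  by rewrite big_split /= -!mulr_sumr x1 y1 !mulr1 subrK.
move: xS yS; rewrite !powersetE => /subsetP xS /subsetP yS; apply/subsetP => v.
rewrite inE !mxE => xy; case: (ltrP 0 (x ord0 (enum_rank v))) => [xv|xv].
  by apply: xS; rewrite inE.
apply: yS; rewrite inE lt_neqAle y0 andbT; apply: contraTneq xy => <-.
by rewrite mulr0 addr0 -leNgt mulr_ge0_le0.
Qed.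

(** The extension is the radial cone to a vertex: the centre of the disk goes to [vertex_pt v], and
    each radius goes to the segment ending at the value of [f]. *)
Lemma homot_vanish_simplex (S : {set T}) j : S != set0 -> homot_vanish (powerset S) j.
Proof.
case/set0Pn => v vS f /within_cont_on fc fS.
have rv : realization (powerset S) (vertex_pt v).
  by apply: realization_vertex; rewrite powersetE sub1set.
have nv := realization_norm rv.
pose dir (x : 'rV[R]_j.+1) := `|x|^-1 *: x.
have dirS x : x != 0 -> sphere (dir x).
  by move=> x0; rewrite /sphere /= normrZ normfV normr_id mulVf ?normr_eq0.
pose g x := (1 - `|x|) *: vertex_pt v + `|x| *: f (dir x).
have nf x : x != 0 -> `|f (dir x)| <= 1.
  by move=> x0; apply: realization_norm (fS _ (dirS _ x0)).
exists g; split.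
- apply/within_cont_on => x; rewrite /disk /= => x1 e e0.
  have [->|x0] := eqVneq x 0.
    exists (e / 2) => [|y _]; first by rewrite divr_gt0.
    rewrite sub0r normrN /g normr0 subr0 scale1r scale0r addr0 => ye.
    have [->|y0] := eqVneq y 0.
      by rewrite normr0 subr0 scale1r scale0r addr0 subrr normr0.
    have -> : vertex_pt v - ((1 - `|y|) *: vertex_pt v + `|y| *: f (dir y)) =
        `|y| *: (vertex_pt v - f (dir y)).
      by apply/rowP => i; rewrite !mxE; ring.
    rewrite normrZ normr_id.
    have : `|vertex_pt v - f (dir y)| <= 2.
      by rewrite (le_trans (ler_normB _ _)) //; have := nf y y0; lra.
    move=> h; rewrite (le_lt_trans (ler_wpM2l (normr_ge0 _) h)) //; lra.
  have nx : 0 < `|x| by rewrite normr_gt0.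
  have e2 : 0 < e / 2 by rewrite divr_gt0.
  have [dl dl0 H] := fc _ (dirS x x0) _ e2.
  (* The three bounds control the change of radius, the change of direction, and keep [y] away from
     0. *)
  exists (Order.min (e / 4) (Order.min (dl * `|x| / 2) `|x|)).
    by rewrite !lt_min divr_gt0 //= nx andbT !mulr_gt0 // invr_gt0.
  move=> y _; rewrite !lt_min => /and3P[xy1 xy2 xy3].
  have y0 : y != 0 by apply: contraTneq xy3 => ->; rewrite subr0 ltxx.
  have dxy : `| `|y| - `|x| | <= `|x - y| by rewrite distrC; exact: ler_dist_dist.
  have /H fxy : `|dir x - dir y| < dl.
    have -> : dir x - dir y = `|x|^-1 *: ((x - y) + (`|y| - `|x|) *: dir y).
      rewrite /dir scalerBl !scalerA; apply/rowP => i; rewrite !mxE.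
      have : `|y| != 0 by rewrite normr_eq0.
      have : `|x| != 0 by rewrite normr_eq0.
      by move=> *; field; apply/andP.
    rewrite normrZ normfV normr_id mulrC ltr_pdivrMr //.
    apply: le_lt_trans (ler_normD _ _) _; rewrite normrZ (dirS y y0) mulr1.
    by move: xy2 dxy; lra.
  have {}fxy := fxy (dirS y y0).
  have -> : g x - g y = (`|x| - `|y|) *: (f (dir y) - vertex_pt v) + `|x| *: (f (dir x) - f (dir y)).
    by apply/rowP => i; rewrite !mxE; ring.
  apply: le_lt_trans (ler_normD _ _) _; rewrite !normrZ normr_id distrC.
  have h1 : `|f (dir y) - vertex_pt v| <= 2.
    by rewrite (le_trans (ler_normB _ _)) //; have := nf y y0; lra.
  have h2 : `| `|y| - `|x| | * `|f (dir y) - vertex_pt v| <= `|x - y| * 2 by apply: ler_pM.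
  have h3 : `|x| * `|f (dir x) - f (dir y)| <= `|f (dir x) - f (dir y)|.
    by rewrite -[leRHS]mul1r ler_wpM2r.
  by move: xy1 h2 h3 fxy; lra.
- move=> x; rewrite /disk /= => x1; rewrite /g.
  have [->|x0] := eqVneq x 0; first by rewrite normr0 subr0 scale1r scale0r addr0.
  by apply: realization_segment => //; [rewrite normr_ge0 x1|exact: fS (dirS _ _)].
- by move=> x; rewrite /sphere /= /g /dir => ->; rewrite subrr scale0r add0r invr1 !scale1r.
Qed.

End Homotopy.

(** * Extending a map over one cell *)

Section CellMap.
Local Open Scope ring_scope.
Import Order.TTheory GRing.Theory Num.Theory numFieldNormedType.Exports.
Local Notation R := Rdefinitions.R.
Variables (T : finType) (m : nat).
Implicit Types (A B : {set 'I_m}) (K : {set {set T}}).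

Definition in_cell A B (x : 'rV[R]_m) :=
  forall i, (i \in B)%:R <= x ord0 i <= (i \in A :|: B)%:R.

Lemma compact_cell A B : compact (in_cell A B : set 'rV[R]_m).
Proof.
exact: (@rV_compact R m (fun i => [set` `[(i \in B)%:R : R, (i \in A :|: B)%:R]%R])%classic
  (fun i => @segment_compact R _ _)).
Qed.

Lemma in_cell_face1 A B (i : 'I_m) x : i \in A ->
  in_cell (A :\ i) (i |: B) x <-> in_cell A B x /\ x ord0 i = 1.
Proof.
move=> iA; split=> [xc|[xc xi] k].
  have x1 : x ord0 i = 1.
    by have := xc i; rewrite !inE eqxx /= => /andP[? ?]; apply/eqP; rewrite eq_le; apply/andP.
  split=> // k; have := xc k; rewrite !inE; case: (k =P i) => [->|_] //=.
  by rewrite iA x1 lexx andbT lern1; case: (i \in B).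
have := xc k; rewrite !inE; case: (k =P i) => [->|_] //=.
by rewrite xi lexx.
Qed.

Lemma in_cell_face0 A B (i : 'I_m) x : i \in A -> i \notin B ->
  in_cell (A :\ i) B x <-> in_cell A B x /\ x ord0 i = 0.
Proof.
move=> iA iB; split=> [xc|[xc xi] k].
  have x0 : x ord0 i = 0.
    have := xc i; rewrite !inE eqxx (negPf iB) /= => /andP[? ?].
    by apply/eqP; rewrite eq_le; apply/andP.
  split=> // k; have := xc k; rewrite !inE; case: (k =P i) => [->|_] //=.
  by rewrite iA x0 (negPf iB) lexx ler01.
have := xc k; rewrite !inE; case: (k =P i) => [->|_] //=.
by rewrite xi (negPf iB) lexx.
Qed.

(** The norm is the sup norm, so [disk] is a cube and the affine maps [p] and [q] identify it with
    the cell. [F] is known to be continuous only on each facet, so continuity on the whole sphere is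
    glued from the facets. *)
Lemma extend_over_cell A B K j (F : 'rV[R]_m -> 'rV[R]_#|T|) :
  [disjoint A & B] -> #|A| = j.+1 -> homot_vanish K j ->
  (forall i, i \in A -> cont_on (in_cell (A :\ i) B) F /\
     forall x, in_cell (A :\ i) B x -> realization K (F x)) ->
  (forall i, i \in A -> cont_on (in_cell (A :\ i) (i |: B)) F /\
     forall x, in_cell (A :\ i) (i |: B) x -> realization K (F x)) ->
  exists g, [/\ cont_on (in_cell A B) g, forall x, in_cell A B x -> realization K (g x) &
    forall x i, in_cell A B x -> i \in A -> x ord0 i = 0 \/ x ord0 i = 1 -> g x = F x].
Proof.
move=> dAB cA hK F0 F1.
have [i0 i0A] : exists i, i \in A by apply/set0Pn; rewrite -card_gt0 cA.
pose io (k : 'I_j.+1) : 'I_m := enum_val (cast_ord (esym cA) k).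
pose ro (i : 'I_m) : 'I_j.+1 := cast_ord cA (enum_rank_in i0A i).
have ioA k : io k \in A by exact: enum_valP.
have roK i : i \in A -> io (ro i) = i.
  by move=> iA; rewrite /io /ro cast_ordK enum_rankK_in.
have ioK k : ro (io k) = k.
  by rewrite /io /ro enum_valK_in cast_ordKV.
have nB i : i \in A -> i \notin B by move=> iA; rewrite (disjointFr dAB).
pose p (y : 'rV[R]_j.+1) : 'rV[R]_m :=
  \row_i (if i \in A then (1 + y ord0 (ro i)) / 2 else (i \in B)%:R).
pose q (x : 'rV[R]_m) : 'rV[R]_j.+1 := \row_k (2 * x ord0 (io k) - 1).
have pq x : in_cell A B x -> p (q x) = x.
  move=> xc; apply/rowP => i; rewrite !mxE; case: ifPn => iA.
    by rewrite roK //; field.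
  by have := xc i; rewrite !inE (negPf iA) /= -eq_le => /eqP.
have pc y : `|y| <= 1 -> in_cell A B (p y).
  move=> /rV_norm_le - /(_ ler01) y1 i; rewrite mxE !inE; case: ifPn => iA; last by rewrite /= lexx.
  have := y1 (ro i); rewrite ler_norml (negPf (nB i iA)) /= mulr0n mulr1n => /andP[? ?].
  apply/andP; split; lra.
have pd y y' : `|p y - p y'| <= `|y - y'|.
  apply/rV_norm_le => // i; rewrite !mxE; case: ifP => iA; last by rewrite subrr normr0.
  rewrite -mulrBl opprD addrACA subrr add0r normrM normfV.
  by have := coord_le_norm (y - y') (ro i); rewrite !mxE (@ger0_norm _ 2) //; have := normr_ge0 (y ord0 (ro i) - y' ord0 (ro i)); lra.
have qd x x' : `|q x - q x'| <= 2 * `|x - x'|.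
  apply/rV_norm_le => [|k]; first by rewrite mulr_ge0.
  rewrite !mxE (addrC (2 * _) (-1)) (addrC (2 * _) (-1)) opprD addrACA subrr add0r -mulrBr normrM (@ger0_norm _ 2) //.
  by have := coord_le_norm (x - x') (io k); rewrite !mxE; lra.
have qn x : in_cell A B x -> `|q x| <= 1.
  move=> xc; apply/rV_norm_le => // k; rewrite mxE; have := xc (io k).
  by rewrite inE ioA (negPf (nB _ (ioA k))) /= mulr0n mulr1n ler_norml => /andP[? ?]; apply/andP; split; lra.
have facet (y : 'rV[R]_j.+1) k (b : bool) : `|y| <= 1 -> y ord0 k = (-1) ^+ b ->
    in_cell (A :\ io k) (if b then B else io k |: B) (p y).
  move=> y1 yk; have pk : p y ord0 (io k) = (~~ b)%:R.
    by rewrite mxE ioA ioK yk; case: b {yk}; rewrite ?expr1 ?expr0 /= ?mulr0n ?mulr1n; field.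
  case: b {yk} pk => pk; first by apply/in_cell_face0 => //; [exact: nB|split=> //; exact: pc].
  by apply/in_cell_face1 => //; split=> //; exact: pc.
have sph (y : 'rV[R]_j.+1) : sphere y -> exists k (b : bool), y ord0 k = (-1) ^+ b.
  rewrite /sphere /= => y1; have [|[a k] /= yk] := @mx_norm_neq0 _ _ _ y.
    by rewrite -[mx_norm y]/`|y| y1 oner_eq0.
  move: yk; rewrite -[mx_norm y]/`|y| y1 (ord1 a) => yk.
  have [y0|y0] := lerP 0 (y ord0 k).
    by exists k, false; rewrite expr0 yk ger0_norm.
  by exists k, true; rewrite expr1 yk ltr0_norm // opprK.
have FF k (b : bool) : cont_on (in_cell (A :\ io k) (if b then B else io k |: B)) F /\
     forall x, in_cell (A :\ io k) (if b then B else io k |: B) x -> realization K (F x).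
  by case: b; [exact: F0|exact: F1].
have [||g0 [g0c g0K g0F]] := hK (F \o p).
- apply/within_cont_on => x; rewrite /sphere /= => x1 e e0.
  have [||dl dl0 H] := @common_radius ('I_j.+1 * bool)%type (fun kb d => forall y : 'rV[R]_j.+1, `|y| = 1 ->
     `|x - y| < d -> y ord0 kb.1 = (-1) ^+ kb.2 -> `|F (p x) - F (p y)| < e).
  + by move=> kb d d' dd H y y1 xy; apply: H => //; exact: lt_le_trans xy dd.
  + case=> k b /=; have [xk|xk] := eqVneq (x ord0 k) ((-1) ^+ b).
      have [fc _] := FF k b; have [|dl dl0 H] := fc (p x) _ _ e0; first by apply: facet; rewrite ?x1.
      exists dl => // y y1 xy yk; apply: H; first by apply: facet; rewrite ?y1.
      exact: le_lt_trans (pd _ _) xy.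
    (* A facet not containing [x] is not met within this distance of [x]. *)
    exists `|x ord0 k - (-1) ^+ b|; first by rewrite normr_gt0 subr_eq0.
    move=> y y1 xy yk; have := coord_le_norm (x - y) k; rewrite !mxE yk.
    by rewrite leNgt xy.
  exists dl => // y y1 xy; have [k [b yk]] := sph y y1.
  exact: (H (k, b)).
- move=> y y1; have [k [b yk]] := sph y y1; apply: (FF k b).2; apply: facet => //.
  by move: y1; rewrite /sphere /= => ->.
exists (g0 \o q); split => [x xc e e0|x xc|x i xc iA xi] /=.
- have [|dl dl0 H] := (iffLR (within_cont_on _ _) g0c) (q x) _ e e0; first exact: qn.
  exists (dl / 2) => [|y yc xy]; first by rewrite divr_gt0.
  apply: H; first exact: qn.
  by apply: le_lt_trans (qd _ _) _; move: xy; lra.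
- by apply: g0K; exact: qn.
rewrite g0F /= ?pq //; rewrite /sphere /=; apply/eqP; rewrite eq_le qn //=.
apply: le_trans (coord_le_norm (q x) (ro i)); rewrite mxE roK //.
case: xi => ->; first by rewrite mulr0 sub0r normrN normr1.
by rewrite (_ : 2 * 1 - 1 = 1) ?normr1 //; ring.
Qed.

End CellMap.

(** * Extending a map cell by cell *)

Section CellMapExists.
Local Open Scope ring_scope.
Import Order.TTheory GRing.Theory Num.Theory numFieldNormedType.Exports.
Local Notation R := Rdefinitions.R.
Variables (T : finType) (m : nat).
Implicit Types (A B : {set 'I_m}).
Variables (dom : {set 'I_m} -> bool) (K : {set 'I_m} -> {set 'I_m} -> {set {set T}}).
Hypothesis domU : forall B i, dom B -> dom (i |: B).
Hypothesis K_face : forall A B i, dom B -> [disjoint A & B] -> i \in A ->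
  K (A :\ i) (i |: B) \subset K A B /\ K (A :\ i) B \subset K A B.
Hypothesis K_conn : forall A B, dom B -> [disjoint A & B] ->
  if #|A| is s.+1 then homot_vanish (K A B) s else exists v, [set v] \in K A B.

Lemma disjoint_face1 A B (i : 'I_m) : [disjoint A & B] -> i \in A -> [disjoint A :\ i & i |: B].
Proof.
move=> /pred0P dAB iA; apply/pred0P => k; have := dAB k; rewrite /= !inE.
by case: eqP => //= _; case: (k \in A) => //= ->.
Qed.

Lemma disjoint_face0 A B (i : 'I_m) : [disjoint A & B] -> [disjoint A :\ i & B].
Proof. by apply: disjointWl; exact: subD1set. Qed.

Let good (S : {set {set 'I_m} * {set 'I_m}}) :=
  forall A B, (A, B) \in S -> [/\ dom B, [disjoint A & B] &
    forall i, i \in A -> (A :\ i, i |: B) \in S /\ (A :\ i, B) \in S].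

(** A [good] family is closed under faces. A cell with the largest number of free coordinates is
    removed, the map is built on the rest by induction, and it is then extended over that cell from
    its boundary. *)
Lemma cell_map_on S : good S -> exists F : 'rV[R]_m -> 'rV[R]_#|T|,
  forall A B, (A, B) \in S -> cont_on (in_cell A B) F /\
    forall x, in_cell A B x -> realization (K A B) (F x).
Proof.
have [k] := ubnP #|S|; elim: k S => // k IH S Sk gS.
have [->|[Q0 Q0S]] := set_0Vmem S.
  by exists (fun=> 0) => A B; rewrite inE.
case: (arg_maxnP (fun Q : {set 'I_m} * {set 'I_m} => #|Q.1|) Q0S) => -[A B] /= ABS0 maxA.
have {ABS0} ABS : (A, B) \in S by [].
have [dB dAB fAB] := gS A B ABS.
pose S' := S :\ (A, B).
have gS' : good S'.
  move=> A' B' /setD1P[ne AB'S]; have [dB' dAB' fA] := gS _ _ AB'S.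
  split=> // i iA'; have [f1 f0] := fA i iA'; have := maxA _ AB'S => /=.
  have : (#|A' :\ i| < #|A'|)%N by rewrite (cardsD1 i A') iA'.
  move=> lt le; rewrite !inE f1 f0 !andbT !xpair_eqE; split; apply/nandP; left;
   by apply: contraTneq (leq_trans lt le) => ->; rewrite ltnn.
have S'k : (#|S'| < k)%N by move: Sk; rewrite (cardsD1 (A, B)) ABS.
have [F HF] := IH S' S'k gS'.
have facetS i : i \in A -> (A :\ i, i |: B) \in S' /\ (A :\ i, B) \in S'.
  move=> iA; have [f1 f0] := fAB i iA; rewrite !inE f1 f0 !andbT !xpair_eqE.
  split; apply/nandP; left; apply/eqP => /setP/(_ i); by rewrite !inE iA eqxx.
(* A point shared with another cell lies on a proper face, by maximality of [A]. *)
have shared A' B' x : (A', B') \in S' -> in_cell A B x -> in_cell A' B' x ->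
    exists2 i, i \in A & x ord0 i = 0 \/ x ord0 i = 1.
  move=> /setD1P[ne AB'S] xc xc'.
  case: (pickP (fun i => (i \in A) && ((x ord0 i == 0) || (x ord0 i == 1)))) => [i|z].
    by case/andP => iA /orP[] /eqP xi; exists i => //; [left|right].
  have AA' : A \subset A'.
    apply/subsetP => i iA; have := z i; rewrite iA /= => /negbT.
    rewrite negb_or => /andP[x0 x1]; have := xc' i; rewrite inE.
    case: (i \in A') => //=; rewrite -eq_le => /eqP e.
    by move: x0 x1; rewrite -e; case: (i \in B') => /=; rewrite eqxx.
  have eA : A' = A by apply/esym/eqP; rewrite eqEcard AA' /=; exact: (maxA _ AB'S).
  case/eqP: ne; congr pair => //; apply/setP => i.
  have [_ dAB' _] := gS _ _ AB'S; have [iA|iA] := boolP (i \in A).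
    by rewrite (disjointFr dAB iA) (disjointFr dAB') ?eA.
  have := xc i; have := xc' i; rewrite !inE eA (negPf iA) /= -!eq_le => /eqP <-.
  by rewrite eqr_nat; case: (i \in B); case: (i \in B').
have [g [gc gK gF]] : exists g, [/\ cont_on (in_cell A B) g,
    forall x, in_cell A B x -> realization (K A B) (g x) &
    forall x i, in_cell A B x -> i \in A -> x ord0 i = 0 \/ x ord0 i = 1 -> g x = F x].
  have := K_conn dB dAB; case cA: #|A| => [|s] hK.
    have [v vK] := hK; exists (fun=> vertex_pt v); split.
    - by move=> x _ e e0; exists 1 => // y _ _; rewrite subrr normr0.
    - by move=> x _; exact: realization_vertex.
    - by move=> x i _; rewrite (cards0_eq cA) inE.
  apply: extend_over_cell hK _ _ => // i iA; have [f1 f0] := facetS i iA;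
    have [s1 s0] := K_face dB dAB iA.
    have [c r] := HF _ _ f0; split=> // x xc; exact: realization_sub s0 (r x xc).
  have [c r] := HF _ _ f1; split=> // x xc; exact: realization_sub s1 (r x xc).
pose F' x := if `[< in_cell A B x >] then g x else F x.
have F'g x : in_cell A B x -> F' x = g x by move=> xc; rewrite /F' asboolT.
have F'F A' B' x : (A', B') \in S' -> in_cell A' B' x -> F' x = F x.
  move=> Q' xc'; rewrite /F'; case: asboolP => // xc.
  by have [i iA xi] := shared _ _ _ Q' xc xc'; apply: gF xi.
exists F' => A' B' AB'; have [[-> ->]|ne] := eqVneq (A', B') (A, B).
  split=> [x xc e e0|x xc]; last by rewrite F'g //; exact: gK.
  have [dl dl0 H] := gc x xc e e0; exists dl => // y yc xy.
  by rewrite !F'g //; exact: H.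
have Q' : (A', B') \in S' by rewrite !inE ne.
have [c r] := HF _ _ Q'.
split=> [x xc e e0|x xc]; last by rewrite (F'F _ _ _ Q' xc); exact: r.
have [dl dl0 H] := c x xc e e0; exists dl => // y yc xy.
by rewrite !(F'F A' B') //; exact: H.
Qed.

Lemma cell_map_exists : exists F : 'rV[R]_m -> 'rV[R]_#|T|,
  forall A B, dom B -> [disjoint A & B] -> cont_on (in_cell A B) F /\
    forall x, in_cell A B x -> realization (K A B) (F x).
Proof.
have [|F HF] := @cell_map_on [set Q : {set 'I_m} * {set 'I_m} | dom Q.2 && [disjoint Q.1 & Q.2]].
  move=> A B; rewrite inE /= => /andP[dB dAB]; split=> // i iA.
  by rewrite !inE /= domU // dB disjoint_face1 ?disjoint_face0.
by exists F => A B dB dAB; apply: HF; rewrite inE /= dB.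
Qed.

End CellMapExists.

(** * From continuous maps to chain maps *)

Section GridCells.
Variables (m N : nat) (dom : {set 'I_m} -> bool).
Hypothesis N_gt0 : 0 < N.
Implicit Types u : {ffun 'I_m -> nat}.
Hypothesis domU : forall B i, dom B -> dom (i |: B).

(** The pair of [grid_free u] and [grid_top u] is the smallest face of the unit cube containing the
    small cube [u]. *)
Definition grid_top (u : {ffun 'I_m -> nat}) : {set 'I_m} := [set i | u i == N.*2].
Definition grid_free (u : {ffun 'I_m -> nat}) : {set 'I_m} := [set i | 0 < u i < N.*2].
Definition in_grid (u : {ffun 'I_m -> nat}) := (forall i, u i <= N.*2) /\ dom (grid_top u).

Lemma odd_lt_double u i : u i <= N.*2 -> odd (u i) -> 0 < u i < N.*2.
Proof.
move=> le oi; rewrite odd_gt0 //= ltn_neqAle le andbT.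
by apply: contraTneq oi => ->; rewrite odd_double.
Qed.

Lemma in_grid_face u i : in_grid u -> odd (u i) ->
  in_grid (upd u i (u i).+1) /\ in_grid (upd u i (u i).-1).
Proof.
move=> [le du] oi; have /andP[gt0 lt] := odd_lt_double (le i) oi.
split; split=> [k|].
- by rewrite ffunE; case: eqP.
- have [e|ne] := eqVneq (u i).+1 N.*2.
    rewrite (_ : grid_top _ = i |: grid_top u); first exact: domU.
    by apply/setP => k; rewrite !inE ffunE; case: (k =P i) => // _; rewrite e eqxx.
  rewrite (_ : grid_top _ = grid_top u) //; apply/setP => k; rewrite !inE ffunE.
  by case: (k =P i) => // ->; rewrite (negPf ne) ltn_eqF.
- by rewrite ffunE; case: eqP => // _; apply: leq_trans (leq_pred _) (le i).
- rewrite (_ : grid_top _ = grid_top u) //; apply/setP => k; rewrite !inE ffunE.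
  case: (k =P i) => // ->; rewrite (ltn_eqF lt) ltn_eqF //.
  exact: leq_ltn_trans (leq_pred _) lt.
Qed.

Lemma grid_cube_cell (A B : {set 'I_m}) (q : {ffun 'I_m -> 'I_N}) : [disjoint A & B] -> dom B ->
  [/\ in_grid (grid_cube A B q), grid_free (grid_cube A B q) = A & grid_top (grid_cube A B q) = B].
Proof.
move=> dAB dB; have tE : grid_top (grid_cube A B q) = B.
  apply/setP => i; rewrite !inE ffunE; case: ifPn => iA.
    rewrite (disjointFr dAB iA); apply/negbTE; apply/eqP => /(congr1 odd).
    by rewrite /= !odd_double.
  by case: ifPn => iB; rewrite ?eqxx // eq_sym double_eq0; case: N N_gt0.
split=> //.
  split=> [i|]; last by rewrite tE.
  rewrite ffunE; case: ifP => _; last by case: ifP.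
  by rewrite ltn_double.
apply/setP => i; rewrite !inE ffunE; case: ifPn => iA.
  by rewrite /= ltn_Sdouble ltn_ord.
by case: ifP => _; rewrite ?ltnn ?andbF.
Qed.

End GridCells.

(** * Labelling the grid by vertices of the complex *)

Section Discretize.
Local Open Scope ring_scope.
Import Order.TTheory GRing.Theory Num.Theory numFieldNormedType.Exports.
Local Notation R := Rdefinitions.R.
Variables (T : finType) (r : T -> nat) (m : nat) (rI : 'I_m -> nat).
Hypothesis r_inj : injective r.
Hypothesis rI_inj : injective rI.
Implicit Types (A B : {set 'I_m}) (u : {ffun 'I_m -> nat}).
Variables (dom : {set 'I_m} -> bool) (K : {set 'I_m} -> {set 'I_m} -> {set {set T}}).
Hypothesis domU : forall B i, dom B -> dom (i |: B).
Hypothesis K_cplx : forall A B, dom B -> [disjoint A & B] -> is_complex (K A B).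
Hypothesis K_face : forall A B i, dom B -> [disjoint A & B] -> i \in A ->
  K (A :\ i) (i |: B) \subset K A B /\ K (A :\ i) B \subset K A B.

Let eps : R := #|T|.+1%:R^-1.

(** The [#|T|] coordinates sum to 1, so they cannot all be at most [1 / (#|T| + 1)]. *)
Lemma realization_large_coord (L : {set {set T}}) x : realization L x ->
  exists v, eps < x ord0 (enum_rank v).
Proof.
case=> x0 [x1 _]; case: (pickP (fun v : T => eps < x ord0 (enum_rank v))) => [v|z].
  by exists v.
have : \sum_i x ord0 i <= \sum_(i < #|T|) eps.
  by apply: ler_sum => i _; have := z (enum_val i); rewrite enum_valK leNgt => ->.
rewrite x1 sumr_const card_ord /eps -[_ *+ _]mulr_natl ler_pdivlMr ?ltr0Sn // mul1r.
by rewrite ler_nat ltnn.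
Qed.

(** The booleans [s] choose an end of each interval of [u] and are ignored where [u] is even; the
    division by [N.*2] rescales to the unit cube. *)
Definition grid_vertex N (u : {ffun 'I_m -> nat}) (s : {ffun 'I_m -> bool}) : 'rV[R]_m :=
  \row_i ((if odd (u i) then if s i then (u i).+1 else (u i).-1 else u i)%:R / N.*2%:R).

Lemma grid_vertex_in_cell N u s : (0 < N)%N -> in_grid N dom u ->
  in_cell (grid_free N u) (grid_top N u) (grid_vertex N u s).
Proof.
move=> N0 [le _] i; rewrite mxE !inE; set c : nat := if _ then _ else _.
have N2 : 0 < N.*2%:R :> R by rewrite ltr0n double_gt0.
have c_le : (c <= N.*2)%N.
  rewrite /c; case: ifP => [oi|_ //]; have /andP[_ lt] := odd_lt_double (le i) oi.
  by case: ifP => _ //; apply: leq_trans (leq_pred _) _; exact: ltnW.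
rewrite ler_pdivlMr // ler_pdivrMr // -!natrM !ler_nat /c.
have [->|ne] /= := eqVneq (u i) N.*2; first by rewrite odd_double orbT !mul1n leqnn.
have lt : (u i < N.*2)%N by rewrite ltn_neqAle ne le.
rewrite lt orbF andbT; move: c_le; rewrite /c; case: (u i) => [|k] //=.
by rewrite mul1n.
Qed.

Lemma grid_vertex_dist N u s s' : (0 < N)%N ->
  `|grid_vertex N u s - grid_vertex N u s'| <= N%:R^-1.
Proof.
move=> N0; have N0' : 0 < N%:R :> R by rewrite ltr0n.
apply/rV_norm_le => [|i]; first by rewrite invr_ge0 ler0n.
rewrite !mxE -mulrBl normrM normfV normr_nat -mul2n natrM invfM mulrA ler_pdivrMr ?mulVf ?lt0r_neq0 //.
rewrite ler_pdivrMr // mul1r.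
case: ifP => [oi|_]; last by rewrite subrr normr0.
have h : (u i).+1%:R - (u i).-1%:R = 2 :> R by case: (u i) oi => // k _ /=; rewrite -!natr1; ring.
by case: (s i); case: (s' i); rewrite ?subrr ?normr0 // ?[`|_.-1%:R - _|]distrC ?h ?ger0_norm.
Qed.

(** A small cube is carried by the full simplex on the set [W u] of labels of its vertices. A
    nonempty simplex is acyclic, so the carrier theorem applies to the grid. *)
Lemma homotopy_cell_chains :
  (forall A B, dom B -> [disjoint A & B] ->
     if #|A| is s.+1 then homot_vanish (K A B) s else exists v, [set v] \in K A B) ->
  exists M, cell_chain_map rI r dom K M.
Proof.
move=> K_conn; have [F HF] := cell_map_exists domU K_face K_conn.
have eps0 : 0 < eps by rewrite invr_gt0 ltr0Sn.
have [||dl dl0 Hdl] := @common_radius ({set 'I_m} * {set 'I_m})%type (fun Q d =>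
    dom Q.2 -> [disjoint Q.1 & Q.2] -> forall x y, in_cell Q.1 Q.2 x -> in_cell Q.1 Q.2 y ->
    `|x - y| <= d -> `|F x - F y| < eps).
- by move=> Q d d' dd H dQ Qd x y xc yc xy; apply: H => //; exact: le_trans xy dd.
- case=> A B /=; have [[dB dAB]|n] := pselect (dom B /\ [disjoint A & B]); last first.
    by exists 1 => // dB dAB; case: n.
  have [N N0 H] := cont_on_uniform eps0 (@compact_cell m A B) (HF A B dB dAB).1.
  by exists N%:R^-1; [rewrite invr_gt0 ltr0n|move=> _ _ x y; exact: H].
have [k kdl] := ltr_add_invr dl0; rewrite add0r in kdl.
pose N := k.+1.
(* Since [F] varies by less than [eps] on a small cube, a coordinate larger than
   [eps] at one vertex is positive at all of them: [W u] lies in the support of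
   [F] at any vertex of [u]. *)
pose W u := [set v | [exists s, eps < F (grid_vertex N u s) ord0 (enum_rank v)]].
have disj u : [disjoint grid_free N u & grid_top N u].
  by apply/pred0P => i; rewrite /= !inE; case: eqP => [->|]; rewrite ?ltnn ?andbF.
have real u s : in_grid N dom u ->
    realization (K (grid_free N u) (grid_top N u)) (F (grid_vertex N u s)).
  move=> Du; apply: (HF _ _ Du.2 (disj u)).2; exact: grid_vertex_in_cell.
have WK u : in_grid N dom u -> powerset (W u) \subset K (grid_free N u) (grid_top N u).
  move=> Du; apply/subsetP => S; rewrite powersetE => /subsetP SW.
  pose s0 : {ffun 'I_m -> bool} := [ffun=> false].
  have [_ [_ sK]] := real u s0 Du; apply: (K_cplx Du.2 (disj u)).2 sK _.
  apply/subsetP => v /SW; rewrite !inE => /existsP[s sv].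
  have := Hdl (grid_free N u, grid_top N u) Du.2 (disj u) _ _ (@grid_vertex_in_cell N u s isT Du)
    (@grid_vertex_in_cell N u s0 isT Du).
  move=> /(_ (le_trans (@grid_vertex_dist N u s s0 isT) (ltW kdl))).
  move=> /rV_norm_lt - /(_ eps0 (enum_rank v)); rewrite !mxE => /ltr_normlP[_]; lra.
have W0 u : in_grid N dom u -> W u != set0.
  move=> Du; have [v sv] := realization_large_coord (real u [ffun=> false] Du).
  by apply/set0Pn; exists v; rewrite inE; apply/existsP; exists [ffun=> false].
(* The vertices of a facet of [u] are vertices of [u], whence [W] is monotone. *)
have vE u i (b : bool) s : odd (u i) ->
    grid_vertex N (upd u i (if b then (u i).+1 else (u i).-1)) s =
    grid_vertex N u [ffun k => if k == i then b else s k].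
  move=> oi; apply/rowP => k0; rewrite !mxE !ffunE; case: (k0 =P i) => // ->; rewrite oi.
  by case: b => /=; rewrite ?oi //; case: (u i) oi => //= c; rewrite ?negbK // => /negPf ->.
have W_face u i (b : bool) : odd (u i) ->
    W (upd u i (if b then (u i).+1 else (u i).-1)) \subset W u.
  move=> oi; apply/subsetP => v; rewrite !inE => /existsP[s]; rewrite vE // => h.
  by apply/existsP; exists [ffun k => if k == i then b else s k].
have [|||u Du|Phi HPhi] := @acyclic_carrier _ rI rI_inj _ r (in_grid N dom) (fun u => powerset (W u)).
- by move=> u i; apply: in_grid_face.
- move=> u _; split=> [|s t]; rewrite !powersetE ?sub0set //; move=> sW ts; exact: subset_trans ts sW.
- move=> u i _ oi; split; rewrite powersetS; [exact: (W_face u i true)|exact: (W_face u i false)].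
- by apply: simplex_fillable; rewrite ?W0.
apply: (@cell_chains_of_grid _ rI _ r N Phi dom K isT) => A B dB dAB q.
have [Du fE tE] := @grid_cube_cell m N dom isT A B q dAB dB.
have [s e] := HPhi _ Du; split=> //; rewrite odds_grid_cube in s.
by have := WK _ Du; rewrite fE tE => sub; exact: supported_sub sub s.
Qed.

End Discretize.

(** * Both kinds of connectivity give chain maps *)

Section ConnCells.
Local Open Scope ring_scope.
Import Order.TTheory GRing.Theory Num.Theory.
Variables (T : finType).

Definition vrank (x : T) : nat := enum_rank x.

Lemma vrank_inj : injective vrank.
Proof. by move=> x y /ord_inj/enum_rank_inj. Qed.

(* The condition of index [s - 1] in the definition of [eta]: a cell of dimension
   [s] whose boundary is already mapped to [K] can be mapped to [K]. *)
Definition conn_at (e : eta_kind) (K : {set {set T}}) (s : nat) : Prop :=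
  if s is j.+1 then
    if e is EtaPi then homot_vanish K j else fillable vrank K j.+1
  else exists v, [set v] \in K.

(** [conn_at] at [s] is the condition of index [s - 1], and [eta_ge] reaches index [a - 2]. *)
Lemma eta_ge_conn_at e (K : {set {set T}}) (a : int) s : is_complex K ->
  eta_ge e K a -> s%:Z + 1 <= a -> conn_at e K s.
Proof.
move=> cK eK; case: s => [|s] sa /=; first by apply: (eK (-1)); lia.
have : eta_cond e K s%:Z by apply: eK; lia.
by case: e {eK} => //= h; exact: hred_fillable.
Qed.

Lemma simplex_conn_at e (S : {set T}) s : S != set0 -> conn_at e (powerset S) s.
Proof.
move=> S0; case: s => [|s] /=; last first.
  by case: e; [exact: homot_vanish_simplex|apply: simplex_fillable => //; exact: vrank_inj].
by have /set0Pn[v vS] := S0; exists v; rewrite powersetE sub1set.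
Qed.

Variables (m : nat) (dom : {set 'I_m} -> bool) (K : {set 'I_m} -> {set 'I_m} -> {set {set T}}).
Implicit Types (A B : {set 'I_m}) (u : {ffun 'I_m -> nat}).
Let rI (i : 'I_m) : nat := i.
Let rI_inj : injective rI. Proof. exact: ord_inj. Qed.
Hypothesis domU : forall B i, dom B -> dom (i |: B).
Hypothesis K_cplx : forall A B, dom B -> [disjoint A & B] -> is_complex (K A B).
Hypothesis K_face : forall A B i, dom B -> [disjoint A & B] -> i \in A ->
  K (A :\ i) (i |: B) \subset K A B /\ K (A :\ i) B \subset K A B.

(** Homology needs no subdivision: carriers apply to the grid with [N = 1], the unit cube itself. *)
Lemma fillable_cell_chains :
  (forall A B, dom B -> [disjoint A & B] -> fillable vrank (K A B) #|A|) ->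
  exists M, cell_chain_map rI vrank dom K M.
Proof.
move=> K_fill.
have disj u : [disjoint odds u & grid_top 1 u].
  by apply/pred0P => i; rewrite /= !inE; apply/negbTE/nandP; case: eqP => [->|]; [left|right].
have [||||Phi HPhi] := @acyclic_carrier _ rI rI_inj _ vrank (in_grid 1 dom)
    (fun u => K (odds u) (grid_top 1 u)).
- by move=> u i; apply: in_grid_face.
- by move=> u [_ du]; apply: K_cplx.
- move=> u i [le du] oi; have u1 : u i = 1%N by case: (u i) oi (le i) => [|[|[|?]]].
  have iu : i \in odds u by rewrite inE.
  have [f1 f0] := K_face du (disj u) iu; have [-> ->] := odds_face oi; rewrite u1.
  rewrite (_ : grid_top 1 (upd u i 2) = i |: grid_top 1 u); last first.
    by apply/setP => k; rewrite !inE ffunE; case: (k =P i).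
  rewrite (_ : grid_top 1 (upd u i 1.-1) = grid_top 1 u) //.
  by apply/setP => k; rewrite !inE ffunE; case: (k =P i) => // ->; rewrite u1.
- by move=> u [_ du]; apply: K_fill.
apply: (@cell_chains_of_grid _ rI _ vrank 1 Phi dom K isT) => A B dB dAB q.
have [Du _ tE] := @grid_cube_cell m 1 dom isT A B q dAB dB.
by have [s e] := HPhi _ Du; rewrite tE odds_grid_cube in s.
Qed.

Lemma conn_cell_chains e :
  (forall A B, dom B -> [disjoint A & B] -> conn_at e (K A B) #|A|) ->
  exists M, cell_chain_map rI vrank dom K M.
Proof.
move=> Kc; case: e Kc => Kc.
  apply: (homotopy_cell_chains vrank_inj rI_inj domU K_cplx K_face) => A B dB dAB.
  by have := Kc A B dB dAB; case: #|A|.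
apply: fillable_cell_chains => A B dB dAB; have := Kc A B dB dAB.
case: #|A| => //= -[v vK]; apply: vertex_fillable vK; exact: K_cplx.
Qed.

End ConnCells.

(** * Time slices of the truncated cube *)

Section Slices.
Local Open Scope ring_scope.
Import Order.TTheory GRing.Theory Num.Theory.
Variables (T : finType) (n : nat) (col : T -> 'I_n) (C : {set {set T}}) (d : nat) (e : eta_kind).
Implicit Types (I J : {set 'I_n}) (A B : {set 'I_n.+1}) (E : {set {set T}}).
Hypothesis d_lt : (d < n)%N.

(* In the cube [[0,1]^(n+1)] the last coordinate [tm] is time, and [lf i] is the
   coordinate of colour [i]. *)
Let rI (i : 'I_n.+1) : nat := i.
Let rk (i : 'I_n) : nat := i.
Let lf (i : 'I_n) : 'I_n.+1 := lift ord_max i.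
Let tm : 'I_n.+1 := ord_max.

Definition restr E J : {set {set T}} := [set S in E | col @: S \subset J].

Lemma restr_complex E J : is_complex E -> is_complex (restr E J).
Proof.
move=> [E0 Ed]; split=> [|S S']; rewrite !inE; first by rewrite E0 imset0 sub0set.
case/andP => SE SJ S'S; rewrite (Ed _ _ SE S'S) /=.
exact: subset_trans (imsetS _ S'S) SJ.
Qed.

Lemma restr_sub E E' J J' : E \subset E' -> J \subset J' -> restr E J \subset restr E' J'.
Proof.
move=> /subsetP EE JJ; apply/subsetP => S; rewrite !inE => /andP[/EE -> SJ] /=.
exact: subset_trans SJ JJ.
Qed.

Definition colors A : {set 'I_n} := [set i | lift ord_max i \in A].

Lemma colorsU A B : colors (A :|: B) = colors A :|: colors B.
Proof. by apply/setP => i; rewrite !inE. Qed.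

Lemma tm_lf i : (tm == lf i) = false.
Proof. exact: negbTE (neq_lift _ _). Qed.

Lemma tm_imset I : tm \notin lf @: I.
Proof. by apply/imsetP => -[i _ /eqP]; rewrite tm_lf. Qed.

Lemma lf_inj : injective lf. Proof. exact: lift_inj. Qed.

Lemma colors_lf I : colors (lf @: I) = I.
Proof. by apply/setP => i; rewrite inE (mem_imset _ _ lf_inj). Qed.

Lemma colors_tm A : colors (tm |: A) = colors A.
Proof. by apply/setP => i; rewrite !inE eq_sym tm_lf. Qed.

Definition slice_dom B := (d < #|colors B|)%N.

(* [E0] and [E1] carry what happens at times 0 and 1. *)
Definition slice_carrier E0 E1 A B : {set {set T}} :=
  restr (if tm \in A then C else if tm \in B then E1 else E0) (colors (A :|: B)).

Let bump_ord (i : 'I_n) : bump n i = i. Proof. by rewrite /bump leqNgt ltn_ord. Qed.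

Lemma inc_sgn_lf I i : inc_sgn rI (lf @: I) (lf i) = inc_sgn rk I i.
Proof.
rewrite !inc_sgn_prod big_imset //=; last by move=> x y _ _; exact: lf_inj.
by apply: eq_bigr => j _; rewrite /rI /lf /= !bump_ord.
Qed.

Lemma inc_sgn_tm_lf I i : inc_sgn rI (tm |: lf @: I) (lf i) = inc_sgn rk I i.
Proof.
rewrite inc_sgn_prod (big_setU1 _ (tm_imset I)) -inc_sgn_prod inc_sgn_lf.
by rewrite /rI /lf /= bump_ord ltnNge ltnW // mul1r.
Qed.

Lemma inc_sgn_tm I : inc_sgn rI (tm |: lf @: I) tm = (-1) ^+ #|I|.
Proof.
rewrite inc_sgn_self inc_sgn_prod big_imset /=; last by move=> x y _ _; exact: lf_inj.
under eq_bigr => i _ do rewrite /rI /lf /= bump_ord ltn_ord.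
by rewrite prodr_const.
Qed.

Section ChainMap.
Variables (E0 E1 : {set {set T}}) (M : {set 'I_n.+1} -> {set 'I_n.+1} -> {set T} -> rat).
Hypothesis HM : cell_chain_map rI (@vrank T) slice_dom (slice_carrier E0 E1) M.

(** [Z b I] is the image of [Q_I] at time [b], and [EZ b I i] that of its facet where coordinate [i]
    is 0. [H] and [EH] are their analogues over the whole time interval. *)
Let top (b : bool) I := if b then tm |: lf @: I else lf @: I.
Let Z b I := M (lf @: (~: I)) (top b I).
Let EZ b I i := M (lf @: (~: (i |: I))) (top b I).
Let H I := M (tm |: lf @: (~: I)) (lf @: I).
Let EH I i := M (tm |: lf @: (~: (i |: I))) (lf @: I).

Lemma slice_dom_top b I : (d < #|I|)%N -> slice_dom (top b I).
Proof. by case: b; rewrite /slice_dom /top ?colors_tm colors_lf. Qed.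

Lemma disjoint_top b I J : [disjoint J & I] -> [disjoint lf @: J & top b I].
Proof.
move=> /pred0P JI; apply/pred0P => k /=; apply/negbTE/andP => -[/imsetP[i iJ ->]] h.
have := JI i; rewrite /= iJ /= => /negP; apply; move: h.
by case: b; rewrite /top ?inE 1?[lf i == tm]eq_sym ?tm_lf /= (mem_imset _ _ lf_inj).
Qed.

Lemma disjoint_tm I J : [disjoint J & I] -> [disjoint tm |: lf @: J & lf @: I].
Proof.
move=> JI; apply/pred0P => k; rewrite /= !inE; case: (k =P tm) => [->|_] /=.
  exact: negbTE (tm_imset I).
exact: (pred0P (disjoint_top false JI) k).
Qed.

Lemma lf_setD1 I i : i \notin I -> (lf @: (~: I)) :\ lf i = lf @: (~: (i |: I)).
Proof.
move=> iI; apply/setP => k; rewrite !inE; case: (unliftP ord_max k) => [j ->|->].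
  by rewrite -/(lf j) !(mem_imset _ _ lf_inj) (inj_eq lf_inj) !inE negb_or.
by rewrite !(negPf (tm_imset _)) andbF.
Qed.

Lemma topU1 b I i : lf i |: top b I = top b (i |: I).
Proof. by case: b; rewrite /top imsetU1 // setUCA. Qed.

Lemma card_setC_ord I : #|~: I| = (n - #|I|)%N.
Proof. by rewrite cardsCs setCK card_ord. Qed.

Lemma disjoint_setC I : [disjoint ~: I & I].
Proof. by apply/pred0P => i; rewrite /= inE andNb. Qed.

Lemma disjoint_setCU1 I i : [disjoint ~: (i |: I) & I].
Proof. by apply: disjointWl (disjoint_setC I); rewrite setCS subsetUr. Qed.

Lemma slice_bd b I : (d < #|I|)%N -> forall S, bd (@vrank T) (Z b I) S =
  if I == setT then (S == set0)%:R else
  \sum_(i | i \notin I) inc_sgn rk (~: I) i * (Z b (i |: I) S - EZ b I i S).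
Proof.
move=> dI S; have [_ ->] := HM (slice_dom_top b dI) (disjoint_top b (disjoint_setC I)).
have -> : (lf @: (~: I) == set0) = (I == setT).
  by rewrite imset_eq0 -(inj_eq (@setC_inj _)) setCK setC0.
case: eqP => // _.
rewrite big_imset /=; last by move=> x y _ _; exact: lf_inj.
apply: eq_big => [i|i]; rewrite inE // => iI.
by rewrite inc_sgn_lf lf_setD1 // topU1.
Qed.

(** Time is the last coordinate, so the sign of its facets counts the [n - d.+1] free colours. *)
Lemma prism_bd I : #|I| = d.+1 -> forall S, bd (@vrank T) (H I) S =
  (-1) ^+ (n - d.+1) * (Z true I S - Z false I S) +
  \sum_(i | i \notin I) inc_sgn rk (~: I) i * (H (i |: I) S - EH I i S).
Proof.
move=> dI S; have dI' : (d < #|I|)%N by rewrite dI.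
have [_ ->] := HM (slice_dom_top false dI') (disjoint_tm (disjoint_setC I)).
rewrite ifF; last by apply/negP => /eqP/setP/(_ tm); rewrite !inE eqxx.
rewrite big_setU1 ?tm_imset //=; congr (_ + _).
  rewrite inc_sgn_tm setU1K ?tm_imset //; congr (_ ^+ _ * _).
  by rewrite card_setC_ord dI.
rewrite big_imset /=; last by move=> x y _ _; exact: lf_inj.
apply: eq_big => [i|i]; rewrite inE // => iI.
rewrite inc_sgn_tm_lf; congr (_ * (M _ _ S - M _ _ S)).
- by rewrite setDUl lf_setD1 // (setDidPl _) // disjoints1 inE tm_lf.
- exact: (topU1 false).
- by rewrite setDUl lf_setD1 // (setDidPl _) // disjoints1 inE tm_lf.
Qed.

Lemma slice_supported b I : (d < #|I|)%N ->
  supported (Z b I) (if b then E1 else E0) (n - #|I|).+1.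
Proof.
move=> dI S nz; have [/(_ S nz)[]] := HM (slice_dom_top b dI) (disjoint_top b (disjoint_setC I)).
rewrite inE (negPf (tm_imset _)) => /andP[SE _] cS _; split.
  move: SE; rewrite /top; case: (b); first by rewrite setU11.
  by rewrite (negPf (tm_imset _)).
by rewrite cS card_imset ?card_setC_ord //; exact: lf_inj.
Qed.

Lemma prism_supported I : #|I| = d.+1 -> supported (H I) C (n - d).+1.
Proof.
move=> dI S nz; have dI' : (d < #|I|)%N by rewrite dI.
have [/(_ S nz)[]] := HM (slice_dom_top false dI') (disjoint_tm (disjoint_setC I)).
rewrite inE setU11 => /andP[SC _] cS _; split=> //.
rewrite cS cardsU1 tm_imset card_imset; last exact: lf_inj.
by rewrite card_setC_ord dI add1n subnSK.
Qed.

(** On this facet colour [i] is neither free nor equal to 1, so its carrier excludes it. *)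
Lemma slice_avoid b I i S : (d < #|I|)%N -> i \notin I -> EZ b I i S != 0 -> i \notin col @: S.
Proof.
move=> dI iI nz.
have [/(_ S nz)[]] := HM (slice_dom_top b dI) (disjoint_top b (disjoint_setCU1 I i)).
rewrite inE => /andP[_ /subsetP sub] _ _; apply/negP => /sub.
rewrite colorsU colors_lf !inE eqxx /=.
by case: b {sub nz}; rewrite /= ?inE 1?[_ == tm]eq_sym ?tm_lf /= (mem_imset _ _ lf_inj) (negPf iI).
Qed.

Lemma prism_avoid I i S : #|I| = d.+1 -> i \notin I -> EH I i S != 0 -> i \notin col @: S.
Proof.
move=> dI iI nz; have dI' : (d < #|I|)%N by rewrite dI.
have [/(_ S nz)[]] := HM (slice_dom_top false dI') (disjoint_tm (disjoint_setCU1 I i)).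
rewrite inE => /andP[_ /subsetP sub] _ _; apply/negP => /sub.
by rewrite colorsU colors_tm !colors_lf !inE eqxx (negPf iI).
Qed.

Lemma slice_degree b :
  \sum_(I : {set 'I_n} | #|I| == d.+1) bd rk (col_chain (@vrank T) col (Z b I)) (~: I) = 1.
Proof.
apply: (col_degree_eq1 (@vrank_inj T) (d := d) (E := EZ b)) => [|I i S|]; last by rewrite ltnSn.
  exact: slice_bd.
exact: slice_avoid.
Qed.

(** Without such a simplex every term of the degree would vanish, although the degree is 1. *)
Lemma slice_rainbow : exists2 S, S \in E0 & rainbow col S && (#|S| == n - d)%N.
Proof.
case: (pickP (fun S => [&& S \in E0, rainbow col S & (#|S| == n - d)%N])) => [S /and3P[]|z].
  by move=> *; exists S => //; apply/andP.
have := slice_degree false; rewrite big1 => [/eqP|I /eqP dI]; first by rewrite eq_sym oner_eq0.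
rewrite /bd big1 // => i _; rewrite /col_chain big1 ?mulr0 // => S /andP[rS _].
have [->|nz] := eqVneq (Z false I S) 0; first by rewrite mulr0.
have [|SE cS] := @slice_supported false I _ S nz; first by rewrite dI.
by have := z S; rewrite SE rS cS dI /= subnSK ?eqxx.
Qed.

(** At time [b] the chains in question live on simplices with [n - d] vertices inside the prescribed
    simplex, hence on that simplex alone. So the [P]-part of the degree is 1 or 0 according to
    whether it satisfies [P]. *)
Lemma slice_invariant (P : pred {set T}) S0 S1 : E0 = powerset S0 -> E1 = powerset S1 ->
  #|S0| = (n - d)%N -> #|S1| = (n - d)%N ->
  (forall S u v, S \in C -> #|S| = (n - d).+1 -> u \in S -> v \in S ->
     rainbow col (S :\ u) -> rainbow col (S :\ v) -> P (S :\ u) = P (S :\ v)) ->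
  P S0 = P S1.
Proof.
move=> e0 e1 c0 c1 Pc.
have degE b S' : (if b then E1 else E0) = powerset S' -> #|S'| = (n - d)%N ->
   \sum_(I : {set 'I_n} | #|I| == d.+1)
     bd rk (col_chain (@vrank T) col (fun S => (P S)%:R * Z b I S)) (~: I) = (P S')%:R.
  move=> eb cS'; rewrite -[RHS]mulr1 -(slice_degree b) mulr_sumr.
  apply: eq_bigr => I /eqP dI; rewrite -bdZ; apply: eq_bd => B; rewrite -col_chainZ.
  apply: eq_col_chain => S _; have [->|nz] := eqVneq (Z b I S) 0; first by rewrite !mulr0.
  have [|SE cS] := @slice_supported b I _ S nz; first by rewrite dI.
  rewrite eb powersetE in SE; suff -> : S = S' by [].
  by apply/eqP; rewrite eqEcard SE cS' cS dI subnSK ?leqnn.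
have := degree_invariant (@vrank_inj T) Pc prism_supported prism_bd prism_avoid.
rewrite (degE false S0 e0 c0) (degE true S1 e1 c1) => /eqP; rewrite eqr_nat.
by case: (P S0); case: (P S1).
Qed.

End ChainMap.

(** On a cell of dimension [s] more than [d] colours are fixed to 1. With [I] the set of free or
    fixed colours, this gives [s + d <= #|I|] if time is free and one more at times 0 and 1. *)
Lemma slice_chains E0 E1 : is_complex C -> is_complex E0 -> is_complex E1 ->
  E0 \subset C -> E1 \subset C ->
  (forall I s, (d < #|I|)%N -> (s + d <= #|I|)%N -> conn_at e (restr C I) s) ->
  (forall I s, (d < #|I|)%N -> (s + d < #|I|)%N -> conn_at e (restr E0 I) s) ->
  (forall I s, (d < #|I|)%N -> (s + d < #|I|)%N -> conn_at e (restr E1 I) s) ->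
  exists M, cell_chain_map rI (@vrank T) slice_dom (slice_carrier E0 E1) M.
Proof.
move=> cC c0 c1 s0 s1 kC k0 k1; apply: (@conn_cell_chains _ _ _ _ _ _ _ e).
- move=> B i /leq_trans; apply; apply: subset_leq_card.
  by apply/subsetP => j; rewrite !inE => ->; rewrite orbT.
- by move=> A B _ _; apply: restr_complex; case: ifP => // _; case: ifP.
- move=> A B i dB dAB iA; have sub (X : {set 'I_n.+1}) : X \subset A :|: B -> colors X \subset colors (A :|: B).
    by move=> /subsetP XA; apply/subsetP => j; rewrite !inE => /XA; rewrite inE.
  have h1 : (A :\ i) :|: (i |: B) \subset A :|: B.
    by rewrite setUA [_ :|: [set i]]setUC setD1K.
  have h0 : (A :\ i) :|: B \subset A :|: B by apply: setSU; exact: subD1set.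
  have iB : i \notin B by rewrite (disjointFr dAB).
  split; apply: restr_sub; try exact: sub; rewrite !inE; case: (tm =P i) => //= ei.
    by rewrite ei iA s1.
  by rewrite ei iA (negPf iB) s0.
move=> A B dB dAB; rewrite /slice_carrier colorsU.
have dis : [disjoint colors A & colors B].
  by apply/pred0P => i; rewrite /= !inE; exact: (pred0P dAB).
have dAB' : (d < #|colors A :|: colors B|)%N.
  by apply: leq_trans dB _; apply: subset_leq_card; exact: subsetUr.
have cU : #|colors A :|: colors B| = (#|colors A| + #|colors B|)%N.
  by rewrite cardsU (disjoint_setI0 dis) cards0 subn0.
have cA : #|A| = ((tm \in A) + #|colors A|)%N.
  rewrite (cardsD1 tm) -(card_imset (mem (colors A)) lf_inj); congr (_ + _)%N.
  apply: eq_card => k; rewrite !inE; case: (unliftP ord_max k) => [j ->|->].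
    by rewrite -/(lf j) (mem_imset _ _ lf_inj) inE eq_sym tm_lf.
  by rewrite eqxx /=; apply/esym/negbTE; exact: (tm_imset (colors A)).
move: dB cU; rewrite /slice_dom cA => dB cU.
case: (tm \in A); first by apply: kC => //; rewrite cU; lia.
by case: (tm \in B); [apply: k1|apply: k0] => //; rewrite cU; lia.
Qed.

End Slices.

(** * The reconfiguration graph *)

Section Reconfiguration.
Variables (T : finType) (C : {set {set T}}) (n : nat) (V : 'I_n -> {set T}) (d : nat).
Hypothesis C_cplx : is_complex C.
Hypothesis V_part : is_vpartition C V.
Implicit Types (S : {set T}) (I : {set 'I_n}).

Lemma simplex_vertex S v : S \in C -> v \in S -> v \in cvertices C.
Proof. by case: C_cplx => _ Cd SC vS; rewrite inE; apply: Cd SC _; rewrite sub1set. Qed.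

Section Color.
Variable i0 : 'I_n.

(** The default [i0] is reached only off the vertices of [C]. *)
Definition class_of v : 'I_n := odflt i0 [pick i | v \in V i].

Lemma class_ofP v i : v \in cvertices C -> (v \in V i) = (class_of v == i).
Proof.
case: V_part => _ dV <- /bigcupP[j _ vj]; rewrite /class_of; case: pickP => [k vk|/(_ j)] /=.
  apply/idP/eqP => [vi|<- //]; apply/eqP; apply: contraTT vi => ki.
  by rewrite (disjointFr (dV _ _ ki)).
by rewrite vj.
Qed.

Lemma pcolorful_rainbow S : pcolorful C V S = (S \in C) && rainbow class_of S.
Proof.
rewrite /pcolorful; case SC: (S \in C) => //=.
apply/forallP/imset_injP => [h u v uS vS e|inj i].
  have := h (class_of v); case: (u =P v) => // /eqP uv.
  rewrite leqNgt => /negP[]; apply/card_gt1P; exists u, v; split=> //; rewrite inE ?uS ?vS /=.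
    by rewrite class_ofP ?e // (simplex_vertex SC).
  by rewrite class_ofP // (simplex_vertex SC).
apply/card_le1P => u; rewrite inE => /andP[uS ui] v; rewrite !inE.
apply/andP/eqP => [[vS vi]|->//]; apply: inj => //.
rewrite class_ofP ?(simplex_vertex SC) // in ui; rewrite class_ofP ?(simplex_vertex SC) // in vi.
by rewrite (eqP ui) (eqP vi).
Qed.

Lemma restr_induced I : restr class_of C I = induced C (\bigcup_(i in I) V i).
Proof.
apply/setP => S; rewrite !inE; case SC: (S \in C) => //=.
apply/subsetP/subsetP => sub => [v vS|i /imsetP[v vS ->]].
  apply/bigcupP; exists (class_of v); first by apply: sub; exact: imset_f.
  by rewrite class_ofP // (simplex_vertex SC).
have /bigcupP[j jI] := sub v vS.
by rewrite class_ofP ?(simplex_vertex SC) // => /eqP->.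
Qed.

Lemma restr_powerset (S : {set T}) I :
  restr class_of (powerset S) I = powerset [set v in S | class_of v \in I].
Proof.
apply/setP => A; rewrite !inE; apply/andP/subsetP => [[/subsetP AS /subsetP AI] v vA|sub].
  by rewrite inE AS //= AI // imset_f.
split; apply/subsetP => v; first by move/sub; rewrite inE => /andP[].
by case/imsetP => w /sub; rewrite inE => /andP[_ wI] ->.
Qed.

Hypothesis d_lt : d < n.
Variable e : eta_kind.
Hypothesis conn_C : forall I s, d < #|I| -> s + d <= #|I| -> conn_at e (restr class_of C I) s.

Lemma rg_vertexE S : rg_vertex C V (n - d) S = [&& S \in C, rainbow class_of S & #|S| == n - d].
Proof. by rewrite /rg_vertex pcolorful_rainbow andbA. Qed.

(** Nothing is prescribed at the ends: both end carriers are [C]. *)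
Lemma rg_vertex_exists : exists S, rg_vertex C V (n - d) S.
Proof.
have conn_C' I s : d < #|I| -> s + d < #|I| -> conn_at e (restr class_of C I) s.
  by move=> dI /ltnW; exact: conn_C.
have [M HM] := slice_chains d_lt C_cplx C_cplx C_cplx (subxx _) (subxx _) conn_C conn_C' conn_C'.
by have [S SC rS] := slice_rainbow d_lt HM; exists S; rewrite rg_vertexE SC.
Qed.

Lemma powerset_complex S : is_complex (powerset S).
Proof.
split=> [|A B]; rewrite !powersetE ?sub0set // => AS BA; exact: subset_trans BA AS.
Qed.

(** [S] uses [n - d] colours and [I] has more than [d], so they share one and the restriction is a
    nonempty simplex. *)
Lemma rg_vertex_conn S I s : rg_vertex C V (n - d) S -> d < #|I| ->
  conn_at e (restr class_of (powerset S) I) s.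
Proof.
rewrite rg_vertexE => /and3P[SC rS /eqP cS] dI; rewrite restr_powerset.
apply: simplex_conn_at; have : class_of @: S :&: I != set0.
  apply: contraL dI => /eqP; move=> eSI; rewrite -leqNgt.
  have : #|class_of @: S :|: I| <= n by rewrite -[X in _ <= X]card_ord max_card.
  by rewrite cardsU eSI cards0 subn0 (eqP rS) cS; move: #|I| d_lt => a; lia.
case/set0Pn => i /setIP[/imsetP[v vS ->] iI]; apply/set0Pn; exists v.
by rewrite inE vS.
Qed.

Lemma rg_adj_sym k : symmetric (rg_adj C V k).
Proof. by move=> S S'; rewrite /rg_adj setUC andbCA. Qed.

Lemma rg_vertex_connect S0 S1 : rg_vertex C V (n - d) S0 -> rg_vertex C V (n - d) S1 ->
  connect (rg_adj C V (n - d)) S0 S1.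
Proof.
move=> v0 v1; have sub S : rg_vertex C V (n - d) S -> powerset S \subset C.
  rewrite rg_vertexE => /andP[SC _]; apply/subsetP => A; rewrite powersetE; exact: C_cplx.2 SC.
have [M HM] := slice_chains d_lt C_cplx (powerset_complex S0) (powerset_complex S1) (sub _ v0) (sub _ v1)
  conn_C (fun I s dI _ => rg_vertex_conn s v0 dI) (fun I s dI _ => rg_vertex_conn s v1 dI).
have cv S : rg_vertex C V (n - d) S -> #|S| = n - d by case/andP => _ /eqP.
rewrite -(slice_invariant (P := connect (rg_adj C V (n - d)) S0) d_lt HM erefl erefl (cv _ v0) (cv _ v1)) //.
(* Invariance is applied to the component of [S0]: two distinct rainbow facets of [S] have union
   [S], so they are adjacent. *)
move=> S u v SC cS uS vS ru rv; have [->//|uv] := eqVneq u v.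
have vtx w : w \in S -> rainbow class_of (S :\ w) -> rg_vertex C V (n - d) (S :\ w).
  move=> wS rw; rewrite rg_vertexE rw (C_cplx.2 _ _ SC) ?subD1set //=.
  by move: cS; rewrite (cardsD1 w) wS add1n => -[->].
have adj : rg_adj C V (n - d) (S :\ u) (S :\ v).
  rewrite /rg_adj !vtx // (_ : S :\ u :|: S :\ v = S) ?SC ?cS ?eqxx //.
  apply/setP => w; rewrite !inE; case: (w =P u) => [->|_] //=; last by case: (w \in S); rewrite ?orbT ?andbF.
  by rewrite uv.
by apply/idP/idP => h; apply: connect_trans h (connect1 _); rewrite // rg_adj_sym.
Qed.

End Color.
End Reconfiguration.

Unset Implicit Arguments.

Theorem theorem6p1 (T : finType) (C : {set {set T}}) (n : nat)
    (V : 'I_n -> {set T}) (d : nat) (e : eta_kind) :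
  is_complex C ->
  is_vpartition C V ->
  (forall I : {set 'I_n}, I != set0 ->
     eta_ge e (induced C (\bigcup_(i in I) V i))
            (#|I|%:Z - d%:Z + 1)) ->
  rg_connected C V (n - d).
Proof.
move=> cC pV hV; have [dn|nd] := ltnP d n; last first.
  (* For [d >= n] the truncated difference is 0 and the empty simplex is the only vertex of the
     graph. *)
  have k0 : n - d = 0 by apply/eqP.
  split=> [|S S']; last first.
    by rewrite k0 /rg_vertex !cards_eq0 => /andP[_ /eqP->] /andP[_ /eqP->].
  exists set0; rewrite /rg_vertex /pcolorful cards0 k0 eqxx andbT cC.1.
  by apply/forallP => i; rewrite set0I cards0.
have i0 : 'I_n by exists d.
have conn (I : {set 'I_n}) s : d < #|I| -> s + d <= #|I| -> conn_at e (restr (class_of V i0) C I) s.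
  move=> dI sd; have I0 : I != set0 by rewrite -card_gt0; apply: leq_ltn_trans dI.
  have := hV I I0; rewrite -(restr_induced cC pV i0) => h.
  by apply: eta_ge_conn_at h _; [exact: restr_complex|lia].
split; first exact: (rg_vertex_exists cC pV dn conn).
move=> S S'; exact: (rg_vertex_connect cC pV dn conn).
Qed.
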